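(* Let $\kappa>0$, $s\in[2,\tfrac52)$, and let $(u_0,\rho_0)\in H^s(0,\tfrac12)\times H^{s-1}(0,\tfrac12)$ with $u_0(0)=u_0(\tfrac12)=0$ and $\rho_0(0)=\rho_0(\tfrac12)=0$. Let $(u,\rho)$ be the solution of (IBVP-2HS) on its maximal interval $[0,T)$. Then $(u,\rho)$ does not blow up in $H^1(0,\tfrac12)\times L_2(0,\tfrac12)$ in finite time: for every finite $T'>0$, $$\sup_{t\in[0,T)\cap[0,T']}\Big(\|u(t)\|_{H^1(0,\frac12)}+\|\rho(t)\|_{L_2(0,\frac12)}\Big)<\infty.$$
   Context: $H^s(a,b)$ is the $L_2$-Sobolev space of order $s$ on $(a,b)$. For $\kappa>0$, the initial boundary value problem (IBVP-2HS) on $(0,\tfrac12)$ is $$m_t=-m_xu-2u_xm-\kappa\rho\rho_x,\quad m=-u_{xx},\quad \rho_t=-(\rho u)_x\qquad (t>0,\ x\in(0,\tfrac12)),$$ with $u(0,\cdot)=u_0$, $\rho(0,\cdot)=\rho_0$ on $[0,\tfrac12]$ and $u(t,0)=\rho(t,0)=u(t,\tfrac12)=\rho(t,\tfrac12)=0$ for all $t\ge0$. For such data with $s\in[2,\tfrac52)$ it has a unique solution on a maximal interval $[0,T)$ in $C([0,T);H^s\times H^{s-1})\cap C^1([0,T);H^{s-1}\times H^{s-2})$ over $(0,\tfrac12)$. *)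

(* Defs.v *)
From HB Require Import structures.
From Stdlib Require Import ClassicalEpsilon.
From mathcomp Require Import all_boot all_order all_algebra.
From mathcomp Require Import all_classical all_reals all_analysis.
Set Implicit Arguments. Unset Strict Implicit. Unset Printing Implicit Defensive.
Import Order.TTheory GRing.Theory Num.Theory numFieldNormedType.Exports.
Local Open Scope classical_set_scope.
Local Open Scope ring_scope.

Section Sobolev.
Variable R : realType.
Local Notation mu := (@lebesgue_measure R).

Definition Ihalf : set R := [set x | 0 < x < 2^-1].
Definition Ihalfc : set R := [set x | 0 <= x <= 2^-1].

Definition sq_int (f : R -> R) : Prop :=
  measurable_fun Ihalf f /\ (\int[mu]_(x in Ihalf) ((f x) ^+ 2)%:E < +oo)%E.

Definition L2sq (f : R -> R) : \bar R := (\int[mu]_(x in Ihalf) ((f x) ^+ 2)%:E)%E.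

Definition test_fun (phi : R -> R) : Prop :=
  (forall (n : nat) (x : R), derivable (iter n (@derive1 R R) phi) x 1) /\
  exists a b : R, 0 < a /\ a < b /\ b < 2^-1 /\
    (forall x, (x < a \/ b < x) -> phi x = 0).

Definition weak_deriv (f g : R -> R) : Prop :=
  mu.-integrable Ihalf (EFin \o f) /\ mu.-integrable Ihalf (EFin \o g) /\
  forall phi, test_fun phi ->
    Rintegral mu Ihalf (fun x => f x * derive1 phi x) =
    - Rintegral mu Ihalf (fun x => g x * phi x).

Definition gagliardo (sigma : R) (f : R -> R) : \bar R :=
  (\int[mu]_(x in Ihalf) \int[mu]_(y in Ihalf)
     (((f x - f y) ^+ 2) / (`|x - y| `^ (1 + 2 * sigma)))%:E)%E.

Definition Hderivs (s : R) (f : R -> R) (d : nat -> R -> R) : Prop :=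
  d 0%N = f /\
  (forall j : nat, (j <= Num.truncn s)%N -> sq_int (d j)) /\
  (forall j : nat, (j < Num.truncn s)%N -> weak_deriv (d j) (d j.+1)) /\
  ((Num.truncn s)%:R < s ->
     (gagliardo (s - (Num.truncn s)%:R) (d (Num.truncn s)) < +oo)%E).

Definition inH (s : R) (f : R -> R) : Prop := 0 <= s /\ exists d, Hderivs s f d.

Definition Hsq (s : R) (d : nat -> R -> R) : \bar R :=
  ((\sum_(j < (Num.truncn s).+1) L2sq (d j)) +
   (if ((Num.truncn s)%:R < s)%R then gagliardo (s - (Num.truncn s)%:R)%R (d (Num.truncn s))
    else 0))%E.

(* the H^s(0,1/2) norm (weak derivatives are unique a.e., so it does not
   depend on the chosen family d); meaningful for f in H^s *)
Definition Hnorm (s : R) (f : R -> R) : R :=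
  Num.sqrt (fine (Hsq s (epsilon (inhabits (fun _ _ => 0)) (Hderivs s f)))).

Definition cont_H (s : R) (T : \bar R) (w : R -> R -> R) : Prop :=
  (forall t, 0 <= t -> (t%:E < T)%E -> inH s (w t)) /\
  forall t, 0 <= t -> (t%:E < T)%E -> forall e : R, 0 < e ->
    exists2 delta : R, 0 < delta & forall t', 0 <= t' -> (t'%:E < T)%E ->
      `|t' - t| < delta -> Hnorm s (fun x => w t' x - w t x) < e.

Definition C1_H (s : R) (T : \bar R) (w wt : R -> R -> R) : Prop :=
  cont_H s T w /\ cont_H s T wt /\
  forall t, 0 <= t -> (t%:E < T)%E -> forall e : R, 0 < e ->
    exists2 delta : R, 0 < delta & forall t', 0 <= t' -> (t'%:E < T)%E ->
      t' != t -> `|t' - t| < delta ->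
      Hnorm s (fun x => (w t' x - w t x) / (t' - t) - wt t x) < e.

(* (u, rho) solves (IBVP-2HS) on [0,T) in
   C([0,T); H^s x H^{s-1}) cap C^1([0,T); H^{s-1} x H^{s-2}).
   Pointwise values are those of the continuous representatives on [0,1/2].
   The momentum equation m_t = -m_x u - 2 u_x m - kappa rho rho_x, m = -u_xx,
   is understood in the sense of distributions on (0,1/2) for each t;
   rho_t = -(rho u)_x holds a.e. on (0,1/2) (both sides lie in H^{s-2}). *)
Definition is_solution (kappa s : R) (u0 rho0 : R -> R) (T : \bar R)
  (u rho : R -> R -> R) : Prop :=
  (0 < T)%E /\
  exists ut rhot : R -> R -> R,
    cont_H s T u /\ cont_H (s - 1) T rho /\
    C1_H (s - 1) T u ut /\ C1_H (s - 2) T rho rhot /\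
    (forall x, Ihalfc x -> u 0 x = u0 x /\ rho 0 x = rho0 x) /\
    (forall t, 0 <= t -> (t%:E < T)%E ->
       {within Ihalfc, continuous (u t)} /\ {within Ihalfc, continuous (rho t)} /\
       u t 0 = 0 /\ rho t 0 = 0 /\ u t (2^-1) = 0 /\ rho t (2^-1) = 0) /\
    (forall t, 0 < t -> (t%:E < T)%E ->
       exists ux uxx rhox : R -> R,
         weak_deriv (u t) ux /\ weak_deriv ux uxx /\ weak_deriv (rho t) rhox /\
         (forall phi, test_fun phi ->
            - Rintegral mu Ihalf (fun x => ut t x * derive1 (derive1 phi) x) =
              - Rintegral mu Ihalf (fun x => u t x * uxx x * derive1 phi x)
              + Rintegral mu Ihalf (fun x => ux x * uxx x * phi x)
              - kappa * Rintegral mu Ihalf (fun x => rho t x * rhox x * phi x)) /\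
         (\forall x \ae mu, Ihalf x ->
            rhot t x = - (rhox x * u t x + rho t x * ux x))).

Definition is_maximal_solution (kappa s : R) (u0 rho0 : R -> R) (T : \bar R)
  (u rho : R -> R -> R) : Prop :=
  is_solution kappa s u0 rho0 T u rho /\
  forall (T2 : \bar R) (u2 rho2 : R -> R -> R),
    is_solution kappa s u0 rho0 T2 u2 rho2 -> (T2 <= T)%E.

End Sobolev.
Arguments Ihalf {R}. Arguments Ihalfc {R}.

(* Main.v *)
(** The energy [E(t) = ||u_x(t)||^2 + kappa ||rho(t)||^2] is conserved, and since [u]
    vanishes at the endpoints it controls the [H^1 x L_2] norm. At a fixed time the
    momentum equation says that [u_tx + u u_xx] has the integrable weak derivative
    [kappa rho rho_x - u_x u_xx]; by the du Bois-Reymond lemma it is then a.e. a primitive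
    of it, and integrating by parts against [u_x] (Fubini) gives
    [int u_x u_tx = - kappa int u rho rho_x], with no approximation of [u] by test
    functions. The transport equation gives [int rho rho_t = int u rho rho_x], so the two
    contributions to [E'] cancel. The equations are only assumed for [t > 0]; the [C^1]
    regularity in time makes [E] continuous at [0]. *)

Require Import Defs.
From HB Require Import structures.
From mathcomp Require Import all_boot all_order all_algebra.
From mathcomp Require Import all_classical all_reals all_analysis.
From Stdlib Require Import ClassicalEpsilon.
From mathcomp Require Import measurable_realfun ring lra.
Set Implicit Arguments. Unset Strict Implicit. Unset Printing Implicit Defensive.
Import Order.TTheory GRing.Theory Num.Theory numFieldNormedType.Exports.
Local Open Scope classical_set_scope.
Local Open Scope ring_scope.

(** * Smooth bump functions *)

Section Smooth.
Context {R : realType}.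
Implicit Types (f g : R -> R) (p : {poly R}).

(** At this regularity [u_t] has a single weak derivative, in L_2, and the momentum equation is
    known only against functions vanishing near the endpoints, a class that does not contain [u] in
    general. Passing to a primitive removes the test functions at the price of an unknown constant.
    That constant multiplies the integral of [u_x], which is zero because [u] vanishes at both ends;
    the boundary terms of the later integrations by parts disappear for the same reason. The energy
    is differentiated in time through the integer-order terms of the norms. The Gagliardo term must
    still be shown stable under linear combinations: the norm is defined by choosing a family of
    derivatives, so the norm of a difference quotient carries information only once the quotient is
    known to lie in the space. The final bounds rest on elementary inequalities such as
    [a <= 1 + a^2], since only finiteness is at stake. *)

Fixpoint Cdiff (n : nat) f : Prop :=
  if n is n'.+1 then (forall x : R, derivable f x 1) /\ Cdiff n' (derive1 f) else True.

(** The recursion of [Cdiff] takes the first derivative off and continues with it, which suits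
    inductions on sums, products and affine substitutions; this translates it to the iterated
    derivative in [test_fun]. *)
Lemma CdiffP f : (forall n, Cdiff n f) <->
  (forall n x, derivable (iter n (@derive1 R R) f) x 1).
Proof.
split=> [H n x|H n].
  suff : Cdiff n.+1 f -> derivable (iter n (@derive1 R R) f) x 1 by apply.
  elim: n f {H} => [|n IH] f; first by case.
  by move=> [_ /IH]; rewrite -iterSr.
elim: n f H => // n IH f H; split; first by move=> x; exact: (H 0%N x).
by apply: IH => k x; rewrite -iterSr; exact: H.
Qed.

Lemma CdiffW n f : Cdiff n.+1 f -> Cdiff n f.
Proof. by elim: n f => // n IH f [df /IH]. Qed.

Lemma Cdiff_derive n f f' : (forall x, is_derive x (1:R) f (f' x)) -> Cdiff n f' ->
  Cdiff n.+1 f.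
Proof.
move=> df Cf'; split; first by move=> x; exact: ex_derive.
rewrite (_ : (derive1 f) = f')//; apply/funext => x.
by rewrite derive1E derive_val.
Qed.

Lemma is_derive_derive1 f (x : R) : derivable f x 1 -> is_derive x (1:R) f (derive1 f x).
Proof. by move=> /derivableP; rewrite derive1E. Qed.

Lemma CdiffD n f g : Cdiff n f -> Cdiff n g -> Cdiff n (fun x => f x + g x).
Proof.
elim: n f g => // n IH f g [df Cf] [dg Cg].
apply: (@Cdiff_derive _ _ (fun x => (derive1 f) x + (derive1 g) x)); last exact: IH.
by move=> x; apply: is_deriveD; exact: is_derive_derive1.
Qed.

Lemma CdiffM n f g : Cdiff n f -> Cdiff n g -> Cdiff n (fun x => f x * g x).
Proof.
elim: n f g => // n IH f g /[dup] /CdiffW Cf0 [df Cf] /[dup] /CdiffW Cg0 [dg Cg].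
apply: (@Cdiff_derive _ _ (fun x => f x * (derive1 g) x + g x * (derive1 f) x)).
  by move=> x; apply: is_deriveM; exact: is_derive_derive1.
by apply: CdiffD; exact: IH.
Qed.

Lemma Cdiff_cst n (c : R) : Cdiff n (fun=> c).
Proof.
elim: n c => // n IH c.
by apply: (@Cdiff_derive _ _ (fun=> 0)); exact: IH.
Qed.

Lemma CdiffZ n (c : R) f : Cdiff n f -> Cdiff n (fun x => c * f x).
Proof. by move=> Cf; apply: CdiffM => //; exact: Cdiff_cst. Qed.

Lemma Cdiff_affine n (c d : R) f : Cdiff n f -> Cdiff n (fun x => f (c * x + d)).
Proof.
elim: n f => // n IH f [df Cf].
apply: (@Cdiff_derive _ _ (fun x => c * (derive1 f) (c * x + d))).
  move=> x; have dg : is_derive x (1:R) (fun x => c * x + d) c.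
    rewrite (_ : (fun x => c * x + d) = (c \*: id) + cst d)//.
    apply: is_derive_eq; rewrite addr0/= .
    exact: mulr1.
  rewrite mulrC; apply: (@is_derive1_comp _ f (fun x => c * x + d)) => //.
  exact: is_derive_derive1.
by apply: CdiffZ; exact: IH.
Qed.

(* [p(1/x) exp(-1/x)] continued by 0: the family is closed under differentiation. *)
Definition flat p (x : R) : R := if 0 < x then p.[x^-1] * expR (- x^-1) else 0.

(** One term of the exponential series gives [z^i <= i! exp z] for [z >= 0]; the constant sums this
    over the coefficients. *)
Lemma horner_expRN_bounded p : exists2 C, 0 <= C &
  forall z, 0 <= z -> `|p.[z] * expR (- z)| <= C.
Proof.
exists (\sum_(i < size p) `|p`_i| * (i`!)%:R).
  by apply: sumr_ge0 => i _; rewrite mulr_ge0.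
move=> z z0; rewrite horner_coef mulr_suml.
apply: (le_trans (ler_norm_sum _ _ _)); apply: ler_sum => i _.
rewrite -mulrA normrM ler_wpM2l// ger0_norm; last first.
  by rewrite mulr_ge0 ?exprn_ge0// expR_ge0.
rewrite expRN ler_pdivrMr ?expR_gt0//.
case: (nat_of_ord i) => [|k].
  by rewrite expr0 fact0 mul1r -expR0 ler_expR.
have := @expR_ge1Dxn R z k z0.
have f0 : 0 < (k.+1`!)%:R :> R by rewrite ltr0n fact_gt0.
move=> H; rewrite [leRHS]mulrC -ler_pdivrMr//; apply: le_trans H.
by rewrite lerDr.
Qed.

(** The difference quotient at 0 is at most [C |h|]. This settles the differentiability of [flat p]
    at its seam. *)
Lemma is_derive_sqr_bound f (C : R) : (forall y, `|f y| <= C * y ^+ 2) ->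
  is_derive (0:R) 1 f 0.
Proof.
move=> fC.
have C0 : 0 <= C.
  by have := fC 1; rewrite expr1n mulr1; apply: le_trans.
have f0 : f 0 = 0.
  by apply/normr0_eq0/eqP; rewrite eq_le normr_ge0 andbT (le_trans (fC 0))// expr0n mulr0.
have L : h^-1 *: (f (h *: 1 + 0) - f 0) @[h --> 0^'] --> (0 : R).
  apply/cvgr0Pnorm_lt => e e0.
  have e1 : 0 < e / (C + 1) by rewrite divr_gt0// ltr_wpDl.
  near=> h.
  have h0 : h != 0 by near: h; exact: nbhs_dnbhs_neq.
  rewrite f0 subr0 addr0 /= [h *: 1]mulr1 normrZ normfV.
  rewrite mulrC ltr_pdivrMr ?normr_gt0//.
  apply: (le_lt_trans (fC h)).
  have -> : h ^+ 2 = `|h| * `|h| by rewrite -expr2 real_normK// num_real.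
  rewrite mulrA ltr_pM2r ?normr_gt0//.
  have hs : `|h| < e / (C + 1).
    by near: h; apply: dnbhs0_lt.
  rewrite ltr_pdivlMr in hs; last by rewrite ltr_wpDl.
  apply: le_lt_trans hs; rewrite mulrC ler_wpM2l// lerDl//.
apply: DeriveDef; first by apply/cvg_ex; exists 0.
exact: cvg_lim L.
Unshelve. all: by end_near. Qed.

(** With [z = 1/x], [z' = - z^2], so [p(z) exp(-z)] has derivative [(p(z) - p'(z)) z^2 exp(-z)]. *)
Lemma is_derive_flat p (x : R) : is_derive x (1:R) (flat p) (flat ((p - p^`()) * 'X ^+ 2) x).
Proof.
have [x0|x0|->] := ltgtP x 0.
- rewrite [flat _ x]/flat ltNge (ltW x0)/=.
  apply: (@near_eq_is_derive _ _ _ (cst 0)).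
  near=> y; rewrite /flat ifF//; apply/negbTE; rewrite -leNgt ltW//.
  by near: y; exact: lt_nbhsl.
- rewrite [flat _ x]/flat x0.
  apply: (@near_eq_is_derive _ _ _ (fun y : R => p.[y^-1] * expR (- y^-1))).
    near=> y; rewrite /flat ifT//.
    by near: y; exact: lt_nbhsr.
  have xn0 : x != 0 by rewrite gt_eqF.
  have d1 : is_derive x (1:R) (fun y : R => y^-1) (- x ^- 2).
    have := @is_deriveV _ id x 1 1 xn0 (is_derive_id _ _).
    by rewrite /= [_ *: 1]mulr1.
  have d2 := @is_derive1_comp _ (horner p) (fun y : R => y^-1) x _ _ (is_derive_poly _ _) d1.
  have d3 := @is_derive1_comp _ expR (fun y : R => - y^-1) x _ _ (is_derive_expR _) (is_deriveN d1).
  have d4 := is_deriveM d2 d3; refine (@is_derive_eq _ _ _ _ _ _ _ _ d4 _) => /=.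
  rewrite !hornerE /= /GRing.scale/=; by field.
- rewrite [flat _ 0]/flat ltxx.
  (* The extra factor ['X^2], evaluated at [1/y], turns the uniform bound into
     [|flat p y| <= C y^2]. *)
  have [C C0 HC] := horner_expRN_bounded (p * 'X ^+ 2).
  apply: (@is_derive_sqr_bound _ C) => y; rewrite /flat.
  case: ltP => [y0|_]; last by rewrite normr0 mulr_ge0// sqr_ge0.
  have yV : 0 <= y^-1 by rewrite invr_ge0 ltW.
  have := HC _ yV; rewrite hornerM hornerXn exprVn -mulrA [_ * expR _]mulrC mulrA.
  by rewrite normrM (ger0_norm (_ : 0 <= y ^- 2)) ?invr_ge0 ?sqr_ge0// ler_pdivrMr ?exprn_gt0.
Unshelve. all: by end_near. Qed.

Lemma Cdiff_flat n p : Cdiff n (flat p).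
Proof.
elim: n p => // n IH p.
by apply: Cdiff_derive (IH _) => x; exact: is_derive_flat.
Qed.

(* Tends to the indicator of [(a, b)] as [k] grows, so no normalization is needed. *)
Definition bump (k : nat) (a b x : R) : R :=
  flat 1 (k%:R * (x - a)) * flat 1 (k%:R * (b - x)).

Lemma flat1_le1 x : 0 <= flat 1 x <= 1.
Proof.
rewrite /flat; case: ifPn => [x0|_]; last by rewrite lexx ler01.
by rewrite hornerE mul1r expR_ge0/= -expR0 ler_expR oppr_le0 invr_ge0 ltW.
Qed.

Lemma bump_ge0_le1 k a b x : 0 <= bump k a b x <= 1.
Proof.
have /andP[h1 h2] := flat1_le1 (k%:R * (x - a)).
have /andP[h3 h4] := flat1_le1 (k%:R * (b - x)).
by rewrite /bump mulr_ge0//= mulr_ile1.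
Qed.

Lemma bump_out k a b x : x <= a \/ b <= x -> bump k a b x = 0.
Proof.
rewrite /bump /flat => -[xa|bx].
- rewrite ifF ?mul0r//; apply/negbTE; rewrite -leNgt.
  by rewrite mulr_ge0_le0// subr_le0.
- rewrite [X in _ * X]ifF ?mulr0//; apply/negbTE; rewrite -leNgt.
  by rewrite mulr_ge0_le0// subr_le0.
Qed.

Lemma Cdiff_bump n k a b : Cdiff n (bump k a b).
Proof.
apply: CdiffM.
- have := @Cdiff_affine n k%:R (- (k%:R * a)) _ (Cdiff_flat n 1).
  by under eq_fun do rewrite -mulrBr.
- have := @Cdiff_affine n (- k%:R) (k%:R * b) _ (Cdiff_flat n 1).
  by under eq_fun do rewrite mulNr addrC -mulrBr.
Qed.

Lemma flat_cvg1 (z : R) : 0 < z -> flat 1 (k%:R * z) @[k --> \oo] --> (1 : R).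
Proof.
move=> z0.
have : expR (- (k.+1%:R * z)^-1) @[k --> \oo] --> (1 : R).
  have H : (fun k : nat => (k.+1%:R * z)^-1) @ \oo --> (0 : R).
    rewrite (_ : (fun k => _) = (fun k => harmonic k * z^-1)); last first.
      by apply/funext => k; rewrite invfM.
    rewrite -[X in _ --> X](mul0r (z^-1)).
    by apply: cvgM; [exact: cvg_harmonic|exact: cvg_cst].
  have HN : (fun k : nat => - (k.+1%:R * z)^-1) @ \oo --> (0 : R).
    by rewrite -[X in _ --> X]oppr0; exact: cvgN.
  rewrite -[in X in _ --> X]expR0.
  exact: (cvg_comp _ _ HN (@continuous_expR R 0)).
rewrite -(@cvg_shiftS _ (fun k => flat 1 (k%:R * z))).
apply: cvg_trans; apply: near_eq_cvg; near=> k.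
by rewrite /= /flat ifT ?mulr_gt0// hornerE mul1r.
Unshelve. all: by end_near. Qed.

Lemma bump_cvg a b x : bump k a b x @[k --> \oo] --> ((a < x < b)%R%:R : R).
Proof.
have [/andP[ax xb]|] := boolP (a < x < b).
  have h1 : 0 < x - a by rewrite subr_gt0.
  have h2 : 0 < b - x by rewrite subr_gt0.
  rewrite -[X in _ --> X](mulr1 1).
  by apply: (@cvgM _ _ _ _ (fun k : nat => flat 1 (k%:R * (x - a)))
    (fun k => flat 1 (k%:R * (b - x)))); exact: flat_cvg1.
rewrite negb_and -!leNgt => /orP H.
under eq_fun do rewrite bump_out//.
exact: cvg_cst.
Qed.

Lemma test_fun_bump k a b : 0 < a -> a < b -> b < 2^-1 -> test_fun (bump k a b).
Proof.
move=> a0 ab b2; split; first by apply/CdiffP => n; exact: Cdiff_bump.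
exists a, b; split => //; split => //; split => // x H; apply: bump_out.
by case: H => /ltW; [left|right].
Qed.

Lemma derive1_0_near f x (A : set R) : open A -> A x ->
  (forall y, A y -> f y = 0) -> (derive1 f) x = 0.
Proof.
move=> oA Ax f0; rewrite derive1E (@near_eq_derive _ _ _ f (cst 0)).
- by rewrite derive_cst.
- by near=> y; rewrite f0//; near: y; exact: open_nbhs_nbhs.
Unshelve. all: by end_near. Qed.

Lemma test_fun_derive f : test_fun f -> test_fun (derive1 f).
Proof.
move=> [df [a [b [a0 [ab [b2 f0]]]]]]; split.
  by move=> n x; rewrite -iterSr; exact: df.
exists a, b; do 3 split => //.
move=> x [xa|bx].
- by apply: (@derive1_0_near f x [set y | y < a]) => // y ya; apply: f0; left.
- by apply: (@derive1_0_near f x [set y | b < y]) => // y ya; apply: f0; right.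
Qed.

End Smooth.

(** * Integrals and primitives on (0, 1/2) *)

Section Primitive.
Context {R : realType}.
Notation mu := (@lebesgue_measure R).
Implicit Types (f g : R -> R).

Definition L1 f : Prop := mu.-integrable Ihalf (EFin \o f).
Definition Ih f : R := Rintegral mu Ihalf f.
(** Truncating the integrand instead of the domain keeps every integral over [Ihalf], so the rules
    for [Ih] apply, and makes [prim f] a function on the whole line, constant on each side of the
    interval. *)
Definition cut f (x y : R) : R := if y < x then f y else 0.
Definition prim f (x : R) : R := Ih (cut f x).

Lemma IhalfE : Ihalf = `]0, 2^-1[%classic :> set R.
Proof. by apply/seteqP; split => x; rewrite /= /Ihalf/= in_itv. Qed.

Lemma measurable_Ihalf : measurable (Ihalf : set (measurableTypeR R)).
Proof. by rewrite IhalfE. Qed.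
Local Notation mI := measurable_Ihalf.

Lemma mu_Ihalf : mu Ihalf = (2^-1)%:E.
Proof.
by rewrite IhalfE lebesgue_measure_itv/= lte_fin invr_gt0 ltr0n/= oppr0 addr0.
Qed.

Lemma L1_measurable f : L1 f -> measurable_fun Ihalf f.
Proof. by move=> /integrableP[/measurable_EFinP]. Qed.

Lemma L1_le f g : measurable_fun Ihalf f ->
  (forall x, Ihalf x -> `|f x| <= `|g x|) -> L1 g -> L1 f.
Proof.
move=> mf fg ig; apply: le_integrable ig => //; first exact: mI.
exact/measurable_EFinP.
Qed.

Lemma L1_cst (c : R) : L1 (fun=> c).
Proof.
apply/integrableP; split; first exact: measurable_cst.
by rewrite integral_cst//= ?mu_Ihalf ?ltry//; exact: mI.
Qed.

Lemma L1D f g : L1 f -> L1 g -> L1 (fun x => f x + g x).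
Proof. by move=> h1 h2; have := integrableD mI h1 h2. Qed.

Lemma L1B f g : L1 f -> L1 g -> L1 (fun x => f x - g x).
Proof. by move=> h1 h2; have := integrableB mI h1 h2. Qed.

Lemma L1Z (c : R) f : L1 f -> L1 (fun x => c * f x).
Proof. by move=> h1; have := integrableZl mI c h1. Qed.

Lemma L1N f : L1 f -> L1 (fun x => - f x).
Proof. by move=> /(L1Z (-1)); under eq_fun do rewrite mulN1r. Qed.

Lemma L1_abs f : L1 f -> L1 (fun x => `|f x|).
Proof. by move=> /integrable_abse. Qed.

Lemma L1_bounded (C : R) f g : measurable_fun Ihalf f ->
  (forall x, Ihalf x -> `|f x| <= C) -> L1 g -> L1 (fun x => f x * g x).
Proof.
move=> mf fC ig; apply: (@L1_le _ (fun x => C * g x)); last exact: L1Z.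
  by apply: measurable_funM => //; exact: L1_measurable.
move=> x Ix; rewrite !normrM ler_wpM2r//.
by rewrite (le_trans (fC x Ix))// ler_norm.
Qed.

Lemma IhD f g : L1 f -> L1 g -> Ih (fun x => f x + g x) = Ih f + Ih g.
Proof. by move=> h1 h2; rewrite /Ih RintegralD//; exact: mI. Qed.

Lemma IhB f g : L1 f -> L1 g -> Ih (fun x => f x - g x) = Ih f - Ih g.
Proof. by move=> h1 h2; rewrite /Ih RintegralB//; exact: mI. Qed.

Lemma IhZ (c : R) f : L1 f -> Ih (fun x => c * f x) = c * Ih f.
Proof. by move=> h1; rewrite /Ih RintegralZl//; exact: mI. Qed.

Lemma IhN f : L1 f -> Ih (fun x => - f x) = - Ih f.
Proof.
move=> h; rewrite -mulN1r -IhZ//; congr Ih.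
by apply/funext => x; rewrite mulN1r.
Qed.

Lemma Ih_cst (c : R) : Ih (fun=> c) = c / 2.
Proof. 
have E : fine (mu Ihalf) = 2^-1 by rewrite mu_Ihalf.
by rewrite -E; exact: (Rintegral_cst mu mI). Qed.

Lemma Ih_le f g : L1 f -> L1 g -> (forall x, Ihalf x -> f x <= g x) -> Ih f <= Ih g.
Proof. by move=> h1 h2 h; apply: le_Rintegral => //; exact: mI. Qed.

Lemma Ih_abs f : L1 f -> `|Ih f| <= Ih (fun x => `|f x|).
Proof. by move=> h; apply: le_normr_Rintegral => //; exact: mI. Qed.

Lemma Ih_ge0 f : (forall x, Ihalf x -> 0 <= f x) -> 0 <= Ih f.
Proof. by move=> h; exact: (@Rintegral_ge0 _ _ _ mu Ihalf f h). Qed.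

Lemma Ih_eq f g : (forall x, Ihalf x -> f x = g x) -> Ih f = Ih g.
Proof. by move=> h; apply: eq_Rintegral => x /set_mem; exact: h. Qed.

Lemma ae_imp (P Q : R -> Prop) : (forall x, P x -> Q x) ->
  {ae mu, forall x, P x} -> {ae mu, forall x, Q x}.
Proof. by move=> PQ; apply: filterS => //; exact: (ae_filter_ringOfSetsType mu). Qed.

Lemma Ih_ae f g : measurable_fun Ihalf f -> measurable_fun Ihalf g ->
  {ae mu, forall x, Ihalf x -> f x = g x} -> Ih f = Ih g.
Proof.
move=> mf mg fg; rewrite /Ih /Rintegral; congr fine.
apply: ae_eq_integral; [exact: mI|exact/measurable_EFinP|exact/measurable_EFinP|].
by apply: ae_imp fg => x /= h /h ->.
Qed.

Lemma L1_eq f g : (forall x, Ihalf x -> f x = g x) -> L1 f -> L1 g.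
Proof.
move=> fg; apply: eq_integrable; first exact: mI.
by move=> x /set_mem Ix /=; rewrite fg.
Qed.

Lemma L1_ae f g : measurable_fun Ihalf g ->
  {ae mu, forall x, Ihalf x -> f x = g x} -> L1 f -> L1 g.
Proof.
move=> mg fg Lf; apply/integrableP; split; first exact/measurable_EFinP.
have /integrableP[mf] := Lf; congr (_ < _)%E.
apply: ae_eq_integral; first exact: mI.
- exact/measurableT_comp.
- by apply/measurableT_comp => //; exact/measurable_EFinP.
- by apply: ae_imp fg => x /= h /h ->.
Qed.

Lemma Ih_fin f : L1 f -> (\int[mu]_(x in Ihalf) (f x)%:E = (Ih f)%:E)%E.
Proof.
move=> Lf; rewrite /Ih /Rintegral fineK//.
by apply: integrable_fin_num => //; exact: mI.
Qed.

Lemma cutE f x : cut f x = f \_ `]-oo, x[.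
Proof.
apply/funext => y; rewrite /cut patchE.
by case: ifPn => yx; [rewrite mem_set//= in_itv|rewrite memNset//= in_itv/=; exact/negP].
Qed.

Lemma measurable_cut f x : measurable_fun Ihalf f -> measurable_fun Ihalf (cut f x).
Proof.
move=> mf; rewrite cutE; apply/measurable_restrict => //; first exact: mI.
by apply: measurable_funS mf => //; exact: mI.
Qed.

Lemma L1_cut f x : L1 f -> L1 (cut f x).
Proof.
move=> Lf; apply: L1_le (Lf); first by apply: measurable_cut; exact: L1_measurable.
by move=> y _; rewrite /cut; case: ifP => // _; rewrite normr0.
Qed.

Lemma restrict_L1 f : L1 f -> mu.-integrable setT (EFin \o (f \_ Ihalf)).
Proof.
move=> Lf; rewrite -restrict_EFin; apply/integrable_restrict => //=; first exact: mI.
by rewrite setTI.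
Qed.

Lemma Ih_restrict f : L1 f -> (\int[mu]_x ((f \_ Ihalf) x)%:E = (Ih f)%:E)%E.
Proof.
move=> Lf; rewrite -Ih_fin// [RHS]integral_mkcond; apply: eq_integral => x _.
by rewrite !patchE; case: ifP.
Qed.

Lemma measurable_gt f (y : R) : measurable_fun Ihalf f ->
  measurable_fun Ihalf (fun x => if y < x then f x else 0).
Proof.
move=> mf; rewrite (_ : (fun x => _) = f \_ `]y, +oo[); last first.
  apply/funext => x; rewrite patchE; case: ifPn => yx.
    by rewrite mem_set//= in_itv/= yx.
  by rewrite memNset//= in_itv/= andbT; exact/negP.
apply/measurable_restrict => //; first exact: mI.
by apply: measurable_funS mf => //; exact: mI.
Qed.

Lemma L1_gt f (y : R) : L1 f -> L1 (fun x => if y < x then f x else 0).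
Proof.
move=> Lf; apply: L1_le (Lf); first by apply: measurable_gt; exact: L1_measurable.
by move=> x _; case: ifP => // _; rewrite normr0.
Qed.

(** The truncations to the two sides of [y] add up to [f] except at the null set [{y}]. *)
Lemma Ih_gt f (y : R) : L1 f ->
  Ih (fun x => if y < x then f x else 0) = Ih f - prim f y.
Proof.
move=> Lf; rewrite /prim -IhB//; last exact: L1_cut.
have mf := L1_measurable Lf.
apply: Ih_ae; first exact: measurable_gt.
  by apply: measurable_funB => //; exact: measurable_cut.
exists [set y]; split => //; first by rewrite lebesgue_measure_set1.
move=> x /= H; apply: contrapT => /eqP xy; apply: H => _.
by move: xy; rewrite /cut; case: ltgtP => // _ _; rewrite ?subr0 ?subrr.
Qed.

(** Fubini for [f(x) g(y)] on the triangle [y < x]: integrating in [y] first gives [f * prim g], in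
    [x] first [g * (Ih f - prim f)]. The integrability of the products is automatic once [prim] is
    known to be bounded and measurable, see [prim_by_parts]. *)
Lemma prim_swap f g : L1 f -> L1 g -> L1 (fun x => f x * prim g x) ->
  L1 (fun x => g x * prim f x) ->
  Ih (fun x => f x * prim g x) + Ih (fun x => g x * prim f x) = Ih f * Ih g.
Proof.
move=> Lf Lg Lfg Lgf.
set f0 := f \_ Ihalf; set g0 := g \_ Ihalf.
have mf0 : measurable_fun setT f0.
  by apply/(measurable_restrictT _ _).1; [exact: mI|exact: L1_measurable].
have mg0 : measurable_fun setT g0.
  by apply/(measurable_restrictT _ _).1; [exact: mI|exact: L1_measurable].
pose K (z : measurableTypeR R * measurableTypeR R) : \bar R :=
  (if z.2 < z.1 then f0 z.1 * g0 z.2 else 0)%:E.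
have mK : measurable_fun setT K.
  apply/measurable_EFinP; apply: measurable_fun_ifT => //.
  - by apply: measurable_fun_ltr => //.
  - by apply: measurable_funM; apply: measurableT_comp.
have iK : (mu \x mu)%E.-integrable setT K.
  apply/integrable12ltyP => //.
  (* By Tonelli it suffices to dominate the kernel by [|f(x)| |g(y)|], whose double integral is
     [a * b]. *)
  pose a := (Ih (fun x => `|f x|)); pose b := (Ih (fun x => `|g x|)).
  have ab h : L1 h -> (\int[mu]_x `|(h \_ Ihalf) x|%:E = (Ih (fun x => `|h x|))%:E)%E.
    move=> Lh; rewrite -Ih_restrict; last exact: L1_abs.
    apply: eq_integral => x _; rewrite !patchE.
    by case: ifP => // _; rewrite normr0.
  apply: (@le_lt_trans _ _ (\int[mu]_x ((`|f0 x| * b)%:E))%E).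
    apply: ge0_le_integral => //.
    + by move=> x _; apply: integral_ge0.
    + apply: (measurable_fun_fubini_tonelli_F (abse \o K)) => //=.
      exact: measurableT_comp.
    + apply/measurable_EFinP; apply: measurable_funM => //.
      exact: measurableT_comp.
    + move=> x _; rewrite EFinM /b -ab// -ge0_integralZl//; last first.
        by apply/measurable_EFinP; apply: measurableT_comp.
      apply: ge0_le_integral => //.
      * by apply: measurableT_comp => //; exact: measurableT_comp.
      * apply: measurable_funeM; apply/measurable_EFinP; exact: measurableT_comp.
      * move=> y _; rewrite /K/= -EFinM lee_fin.
        by case: ifP => _; rewrite ?normrM// normr0 mulr_ge0.
  under eq_integral do rewrite EFinM muleC.
  rewrite ge0_integralZl//.
  - by rewrite ab// -EFinM ltry.
  - by apply/measurable_EFinP; apply: measurableT_comp.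
  - by rewrite lee_fin; apply: Ih_ge0.
have := Fubini iK.
have -> : (\int[mu]_x \int[mu]_y K (x, y) = (Ih (fun x => f x * prim g x))%:E)%E.
  rewrite -Ih_restrict//; apply: eq_integral => x _.
  transitivity ((f0 x)%:E * \int[mu]_y ((cut g x \_ Ihalf) y)%:E)%E.
    rewrite -integralZl//; last by apply: restrict_L1; exact: L1_cut.
    apply: eq_integral => y _; rewrite /K/= -EFinM /f0 /g0 /cut !patchE.
    by case: (y < x); case: ifP => _; rewrite ?mulr0//; case: ifP; rewrite ?mulr0.
  rewrite Ih_restrict; last exact: L1_cut.
  rewrite -EFinM /f0 /prim !patchE; congr EFin.
  by case: ifP => _ //; rewrite mul0r.
have -> : (\int[mu]_y \int[mu]_x K (x, y) =
    (Ih (fun y => g y * (Ih f - prim f y)))%:E)%E.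
  have -> : Ih (fun y => g y * (Ih f - prim f y)) =
            Ih (fun y => Ih f * g y - g y * prim f y).
    by apply: Ih_eq => y _; rewrite mulrBr mulrC.
  rewrite -Ih_restrict; last by apply: L1B => //; exact: L1Z.
  apply: eq_integral => y _.
  have Lc := L1_gt y Lf.
  transitivity ((g0 y)%:E * \int[mu]_x (((fun x => if y < x then f x else 0) \_ Ihalf) x)%:E)%E.
    rewrite -integralZl//; last by apply: restrict_L1.
    apply: eq_integral => x _; rewrite /K/= -EFinM /f0 /g0 !patchE.
    by case: (y < x); case: ifP => _; rewrite ?mulr0 ?mul0r//;
      case: ifP; rewrite ?mulr0 ?mul0r// mulrC.
  rewrite Ih_restrict// Ih_gt//.
  rewrite -EFinM /g0 !patchE; congr EFin.
  by case: ifP => _ //; rewrite ?mul0r// mulrBr; congr (_ - _); rewrite mulrC.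
move=> [->].
have -> : Ih (fun y => g y * (Ih f - prim f y)) =
            Ih (fun y => Ih f * g y - g y * prim f y).
  by apply: Ih_eq => y _; rewrite mulrBr mulrC.
rewrite IhB//; last exact: L1Z.
by rewrite IhZ// subrK.
Qed.

End Primitive.

(** * The du Bois-Reymond lemma *)

Section DuBoisReymond.
Context {R : realType}.
Notation mu := (@lebesgue_measure R).
Implicit Types (f g : R -> R).
Local Notation mI := (@measurable_Ihalf R).

Lemma prim_le0 f x : x <= 0 -> prim f x = 0.
Proof.
move=> x0; rewrite /prim (@Ih_eq _ _ (fun=> 0)) ?Ih_cst ?mul0r// => y /andP[y0 _].
by rewrite /cut ltNge (le_trans x0 (ltW y0)).
Qed.

Lemma prim_ge_half f x : 2^-1 <= x -> prim f x = Ih f.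
Proof.
move=> x0; apply: Ih_eq => y /andP[_ y2].
by rewrite /cut (lt_le_trans y2 x0).
Qed.

Lemma prim_bound f x : L1 f -> `|prim f x| <= Ih (fun y => `|f y|).
Proof.
move=> Lf; apply: (le_trans (Ih_abs (L1_cut x Lf))); apply: Ih_le.
- exact/L1_abs/L1_cut.
- exact: L1_abs.
- by move=> y _; rewrite /cut; case: ifP => // _; rewrite normr0.
Qed.

(** Absolute continuity of the integral on [[y, x[], a set of measure [x - y], gives a modulus valid
    for all pairs of points. *)
Lemma prim_unif f (e : R) : L1 f -> 0 < e ->
  exists2 d : R, 0 < d & forall x y, `|x - y| < d -> `|prim f x - prim f y| <= e.
Proof.
move=> Lf e0.
have [d [d0 Hd]] := integral_normr_continuous (restrict_L1 Lf) e0.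
exists d => // x y; wlog yx : x y / y <= x.
  move=> H; have [|/ltW xy] := leP y x; first exact: H.
  by move=> h; rewrite distrC; apply: H => //; rewrite distrC.
rewrite ger0_norm ?subr_ge0// => xyd.
rewrite /prim -IhB; [|exact: L1_cut..].
have Lc : L1 (fun z => cut f x z - cut f y z) by apply: L1B; exact: L1_cut.
apply: (le_trans (Ih_abs Lc)); apply/ltW.
have mA : measurable (`[y, x[%classic : set (measurableTypeR R)) by [].
have muA : (mu `[y, x[ < d%:E)%E.
  rewrite lebesgue_measure_itv/= lte_fin; case: ifP => _; last by rewrite lte_fin.
  by rewrite -EFinD lte_fin.
have := Hd _ mA muA; congr (_ < _).
rewrite Rintegral_mkcond [RHS]/Ih [RHS]Rintegral_mkcond; congr Rintegral.
apply/funext => z; rewrite !patchE /cut.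
have [zI|zI] := boolP (z \in Ihalf); last by rewrite normr0; case: ifP.
case: ifPn; rewrite ?notin_setE ?inE/= in_itv/=.
  by move=> /andP[yz ->]; rewrite ltNge yz/= subr0.
move=> /negP; rewrite negb_and -leNgt -ltNge => /orP[zy|xz].
  by rewrite zy (lt_le_trans zy yx) subrr normr0.
by rewrite ltNge xz/= ltNge (le_trans yx xz)/= subrr normr0.
Qed.

Lemma prim_continuous f : L1 f -> continuous (prim f).
Proof.
move=> Lf x; apply/cvgrPdist_le => /= e e0.
have [d d0 H] := prim_unif Lf e0.
by exists d => //= y; exact: H.
Qed.

Lemma measurable_prim f : L1 f -> measurable_fun Ihalf (prim f).
Proof.
by move=> Lf; apply: measurable_funTS; apply: continuous_measurable_fun; exact: prim_continuous.
Qed.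

Lemma L1_prim f : L1 f -> L1 (prim f).
Proof.
move=> Lf; apply: (@L1_le _ _ (fun=> Ih (fun y => `|f y|))).
- exact: measurable_prim.
- by move=> x _; rewrite (le_trans (prim_bound x Lf))// ler_norm.
- exact: L1_cst.
Qed.

Lemma L1_mul_prim f g : L1 f -> L1 g -> L1 (fun x => f x * prim g x).
Proof.
move=> Lf Lg; apply: L1_eq (L1_bounded (measurable_prim Lg) (fun x _ => prim_bound x Lg) Lf).
by move=> x _; rewrite mulrC.
Qed.

Lemma prim_by_parts f g : L1 f -> L1 g ->
  Ih (fun x => f x * prim g x) + Ih (fun x => g x * prim f x) = Ih f * Ih g.
Proof. by move=> Lf Lg; apply: prim_swap => //; exact: L1_mul_prim. Qed.

(** Passes to the closed-ray form in which the fundamental theorem of calculus is stated; going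
    through the complement [x < y] lets [Ih_gt] absorb the endpoint. *)
Lemma primE f x : L1 f -> Rintegral mu `]-oo, x] (f \_ Ihalf) = prim f x.
Proof.
move=> Lf.
rewrite -[RHS]opprK -[in RHS](addKr (Ih f) (- prim f x)) -Ih_gt// opprD opprK -IhB//; last exact: L1_gt.
rewrite /Ih [RHS]Rintegral_mkcond Rintegral_mkcond; congr Rintegral.
apply/funext => y; rewrite !patchE; have [yI|yI] := boolP (y \in Ihalf); last by case: ifP.
case: ifPn; rewrite ?notin_setE ?inE/= in_itv/=.
  by move=> yx; rewrite ltNge yx/= subr0.
by move=> /negP; rewrite -ltNge => ->; rewrite subrr.
Qed.

Lemma prim_ae_derive f : L1 f ->
  {ae mu, forall x, derivable (prim f) x 1 /\ derive1 (prim f) x = (f \_ Ihalf) x}.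
Proof.
move=> Lf.
have i0 := restrict_L1 Lf.
have i1 y : mu.-integrable `]-oo, y] (EFin \o f \_ Ihalf) by apply: integrableS i0.
have l1 : locally_integrable [set: R] (f \_ Ihalf) by exact: (integrable_locally mI Lf).
have := FTC1Ny i1 l1.
have -> // : (fun x => Rintegral mu `]-oo, x] (f \_ Ihalf)) = prim f.
by apply/funext => x; exact: primE.
Qed.

(** Vanishing outside the interval identifies [f] with [f \_ Ihalf], a continuous function on the
    line, so the derivative exists at every point, the two ends included. *)
Lemma is_derive_prim f : L1 f -> continuous f -> (forall x, ~ Ihalf x -> f x = 0) ->
  forall x : R, is_derive x 1 (prim f) (f x).
Proof.
move=> Lf cf f0 x.
have E : f \_ Ihalf = f.
  by apply/funext => y; rewrite patchE; case: ifPn => // /negP; rewrite inE => /f0.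
have i0 := restrict_L1 Lf.
have x1 : x < x + 1 by rewrite ltrDl.
have [] := @continuous_FTC1 R f -oo%O x (x + 1) x1.
- by rewrite -E; apply: integrableS i0.
- by rewrite ltNyr.
- exact: cf.
- rewrite (_ : (fun x => _) = prim f); last first.
    by apply/funext => y; rewrite -primE// E.
  by move=> d1 d2; rewrite -d2; exact: is_derive_derive1.
Qed.

(** * Integration against test functions *)

Lemma L1_continuous f : continuous f -> L1 f.
Proof.
move=> cf; have : mu.-integrable `[0, 2^-1]%classic (EFin \o f).
  apply: continuous_compact_integrable; first exact: segment_compact.
  exact: continuous_subspaceT.
apply: integrableS => //; first exact: mI.
by move=> x /andP[x0 x2]; rewrite /= in_itv/= !ltW.
Qed.

Lemma test_fun_continuous f : test_fun f -> continuous f.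
Proof.
by move=> [df _] x; apply: differentiable_continuous; apply/derivable1_diffP; exact: (df 0%N x).
Qed.

Lemma test_fun_out f x : test_fun f -> ~ Ihalf x -> f x = 0.
Proof.
move=> [_ [a [b [a0 [ab [b2 f0]]]]]] Ix; apply: f0.
have [xa|ax] := ltP x a; [by left|right].
rewrite ltNge; apply/negP => xb; apply: Ix; rewrite /Ihalf/=.
by rewrite (lt_le_trans a0 ax) (le_lt_trans xb b2).
Qed.

Lemma test_fun_L1 f : test_fun f -> L1 f.
Proof. by move/test_fun_continuous; exact: L1_continuous. Qed.

Lemma test_fun_bounded f : test_fun f -> exists C, forall x, Ihalf x -> `|f x| <= C.
Proof.
move=> tf; have cf := test_fun_continuous tf.
have cn : continuous (fun x => `|f x|).
  by move=> x; apply: cvg_norm; exact: cf.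
have h02 : (0 : R) <= 2^-1 by rewrite invr_ge0.
have [c _ H] := EVT_max h02 (continuous_subspaceT cn).
by exists `|f c| => x /andP[x0 x2]; apply: H; rewrite in_itv/= !ltW.
Qed.

Lemma L1_test f g : L1 f -> test_fun g -> L1 (fun x => f x * g x).
Proof.
move=> Lf tg; have [C HC] := test_fun_bounded tg.
apply: L1_eq (L1_bounded (L1_measurable (test_fun_L1 tg)) HC Lf).
by move=> x _; rewrite mulrC.
Qed.

(** The difference has zero derivative on the whole line and vanishes at 0. *)
Lemma prim_test_derive f x : test_fun f -> prim (derive1 f) x = f x.
Proof.
move=> tf; have tf' := test_fun_derive tf.
have H (y : R) : is_derive y 1 (fun x => prim (derive1 f) x - f x) (0 : R).
  rewrite -(subrr (derive1 f y)); apply: is_deriveB; last first.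
    by apply: is_derive_derive1; exact: (tf.1 0%N y).
  apply: is_derive_prim; [exact: test_fun_L1|exact: test_fun_continuous|].
  by move=> z; exact: test_fun_out.
apply/eqP; rewrite -subr_eq0; apply/eqP.
rewrite (@is_derive_0_is_cst _ _ x 0 H) prim_le0// (test_fun_out tf) ?subr0//.
by rewrite /Ihalf/= ltxx.
Qed.

Lemma Ih_test_derive f : test_fun f -> Ih (derive1 f) = 0.
Proof.
move=> tf; rewrite -(@prim_ge_half _ 2^-1)// prim_test_derive// (test_fun_out tf)//.
by rewrite /Ihalf/= ltxx andbF.
Qed.

(** The bumps of []a, b[] lie between 0 and 1 and converge pointwise to its indicator; dominated
    convergence makes the integral of [f] over []a, b[] a limit of zeros. *)
Lemma prim_eq_of_test_orthogonal f a b : L1 f -> 0 < a -> a < b -> b < 2^-1 ->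
  (forall phi, test_fun phi -> Ih (fun x => f x * phi x) = 0) ->
  prim f a = prim f b.
Proof.
move=> Lf a0 ab b2 H.
pose fn k x := (f x * bump k a b x)%:E.
pose fl x := (f x * (a < x < b)%R%:R)%:E.
have mf := L1_measurable Lf.
have Lfl : L1 (fun x => cut (fun x => if a < x then f x else 0) b x).
  by apply: L1_cut; exact: L1_gt.
have E x : cut (fun x => if a < x then f x else 0) b x = f x * (a < x < b)%R%:R.
  by rewrite /cut andbC; case: ifP => _ /=; [case: ifP|]; rewrite ?mulr0 ?mulr1.
have Efl : fl = EFin \o (cut (fun x => if a < x then f x else 0) b).
  by apply/funext => x; rewrite /fl -E.
have tb k := test_fun_bump k a0 ab b2.
have m1 k : measurable_fun Ihalf (fn k).
  by apply/measurable_EFinP; exact: (L1_measurable (L1_test Lf (tb k))).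
have m2 : measurable_fun Ihalf fl by rewrite Efl; exact: (measurable_int mu Lfl).
have c1 : {ae mu, forall x, Ihalf x -> fn ^~ x @ \oo --> fl x}.
  apply: aeW => x Ix; apply: cvg_EFin; first by near=> k.
  by apply: cvgM; [exact: cvg_cst|exact: bump_cvg].
have d1 : {ae mu, forall x k, Ihalf x -> (`|fn k x| <= `|f x|%:E)%E}.
  apply: aeW => x k Ix; rewrite /fn/= lee_fin normrM ler_piMr//.
  by have /andP[h1 h2] := bump_ge0_le1 k a b x; rewrite ger0_norm.
have [_ _] := dominated_convergence mI m1 m2 c1 (L1_abs Lf) d1.
rewrite (_ : [sequence _]_n = cst 0%E); last first.
  apply/funext => k; rewrite /fn/= (Ih_fin (L1_test Lf (tb k))).
  by rewrite (H _ (tb k)).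
move=> /(cvg_unique _ (cvg_cst _)) => /(_ (@ereal_hausdorff R)).
rewrite Efl Ih_fin// => -[/esym Z].
have : prim f b - prim f a = 0.
  rewrite -Z /prim -IhB; [|exact: L1_cut..].
  apply: Ih_ae.
  - by apply: measurable_funB; exact: measurable_cut.
  - exact: L1_measurable.
  - exists [set a]; split => //; first by rewrite lebesgue_measure_set1.
    move=> x /= Hx; apply: contrapT => /eqP xa; apply: Hx => _; rewrite /cut.
    case: (ltgtP x a) xa => // xa _; last by rewrite subr0.
    by rewrite (lt_trans xa ab) subrr.
by move=> /eqP; rewrite subr_eq0 => /eqP.
Unshelve. all: by end_near. Qed.

(** The primitive of [f] is constant inside the interval, so its derivative, which is [f] almost
    everywhere, is zero there. *)
Lemma fundamental_lemma f : L1 f ->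
  (forall phi, test_fun phi -> Ih (fun x => f x * phi x) = 0) ->
  {ae mu, forall x, Ihalf x -> f x = 0}.
Proof.
move=> Lf H; apply: ae_imp (prim_ae_derive Lf) => x [_ dx] Ix.
move: dx; rewrite patchE mem_set// => <-.
have C y z : Ihalf y -> Ihalf z -> prim f y = prim f z.
  wlog yz : y z / y <= z.
    move=> W; have [|/ltW zy] := leP y z; first exact: W.
    by move=> Iy Iz; apply/esym/W.
  move: yz; rewrite le_eqVlt => /orP[/eqP->//|yz] /andP[y0 _] /andP[_ z2].
  exact: prim_eq_of_test_orthogonal.
rewrite derive1E (@near_eq_derive _ _ _ _ (cst (prim f x))).
  exact: derive_cst.
near=> y; apply: C => //; near: y; rewrite IhalfE.
apply: open_nbhs_nbhs; split; first exact: itv_open.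
by rewrite -IhalfE.
Unshelve. all: by end_near. Qed.

(** Otherwise the constant 1 would be orthogonal to all test functions, hence zero almost
    everywhere. *)
Lemma exists_test_Ih_neq0 : exists2 eta : R -> R, test_fun eta & Ih eta != 0.
Proof.
apply: contrapT => N.
have : {ae mu, forall x : R, Ihalf x -> (1 : R) = 0}.
  apply: (@fundamental_lemma (fun=> 1)); first exact: L1_cst.
  move=> phi tphi; apply/eqP; apply: contrapT => /negP Z; apply: N; exists phi => //.
  by rewrite (@Ih_eq _ _ (fun x => 1 * phi x))// => x _; rewrite mul1r.
move=> [A [mA A0 sub]].
have : (mu Ihalf <= mu A)%E.
  apply: le_measure; rewrite ?inE//; first exact: mI.
  by move=> x Ix; apply: sub => /= /(_ Ix)/eqP; rewrite oner_eq0.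
by rewrite A0 mu_Ihalf lee_fin leNgt invr_gt0 ltr0n.
Qed.

(** The zero mean is what makes the primitive return to 0 to the right of the support. *)
Lemma test_fun_prim (phi : R -> R) : test_fun phi -> Ih phi = 0 -> test_fun (prim phi).
Proof.
move=> tphi I0; split.
  apply/CdiffP => -[//|n]; apply: (@Cdiff_derive _ _ _ phi); last exact: ((CdiffP _).2 tphi.1).
  move=> x; apply: is_derive_prim; [exact: test_fun_L1|exact: test_fun_continuous|].
  by move=> y; exact: test_fun_out.
have [_ [a [b [a0 [ab [b2 f0]]]]]] := tphi.
exists a, b; do 3 split => //.
move=> x [xa|bx].
  rewrite /prim (@Ih_eq _ _ (fun=> 0)) ?Ih_cst ?mul0r// => y _.
  by rewrite /cut; case: ifP => // yx; apply: f0; left; exact: lt_trans xa.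
have : Ih (fun y => if x < y then phi y else 0) = 0.
  rewrite (@Ih_eq _ _ (fun=> 0)) ?Ih_cst ?mul0r// => y _.
  by case: ifP => // xy; apply: f0; right; exact: lt_trans xy.
rewrite Ih_gt ?I0 ?sub0r; last exact: test_fun_L1.
by move=> /eqP; rewrite oppr_eq0 => /eqP.
Qed.

Lemma test_funBZ (phi eta : R -> R) (c : R) : test_fun phi -> test_fun eta ->
  test_fun (fun x => phi x - c * eta x).
Proof.
move=> [s1 [a [b [a0 [ab [b2 f0]]]]]] [s2 [a' [b' [a0' [ab' [b2' f0']]]]]]; split.
  apply/CdiffP => n; under eq_fun do rewrite -mulNr.
  by apply: CdiffD; [exact: ((CdiffP _).2 s1)|apply: CdiffZ; exact: ((CdiffP _).2 s2)].
exists (Num.min a a'), (Num.max b b'); split; first by rewrite lt_min a0.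
split; first by rewrite gt_min lt_max ab.
split; first by rewrite gt_max b2.
move=> x [|].
  by rewrite lt_min => /andP[h1 h2]; rewrite f0 ?f0' ?mulr0 ?subrr//; left.
by rewrite gt_max => /andP[h1 h2]; rewrite f0 ?f0' ?mulr0 ?subrr//; right.
Qed.

(** The difference [h = f - prim g] is orthogonal to derivatives of test functions, that is, to test
    functions of mean zero; subtracting a multiple of a fixed [eta] brings any test function to mean
    zero. *)
Lemma du_bois_reymond f g : weak_deriv f g ->
  exists c, {ae mu, forall x, Ihalf x -> f x = c + prim g x}.
Proof.
move=> [Lf [Lg fg]].
pose h x := f x - prim g x.
have Lh : L1 h by apply: L1B => //; exact: L1_prim.
have h0 phi : test_fun phi -> Ih (fun x => h x * derive1 phi x) = 0.
  move=> tphi; have tphi' := test_fun_derive tphi; have Lphi' := test_fun_L1 tphi'.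
  have := prim_by_parts Lg Lphi'.
  rewrite Ih_test_derive// mulr0 => /eqP; rewrite addr_eq0 => /eqP.
  rewrite (@Ih_eq _ _ (fun x => g x * phi x)); last by move=> x _; rewrite prim_test_derive.
  move=> P; have {}fg := fg _ tphi.
  transitivity (Ih (fun x => f x * derive1 phi x - derive1 phi x * prim g x)).
    by apply: Ih_eq => x _; rewrite /h mulrBl [prim g x * _]mulrC.
  rewrite IhB; [|exact: L1_test|exact: L1_mul_prim].
  by rewrite [X in X - _]fg -/(Ih _) P opprK subrr.
have [eta teta eta0] := exists_test_Ih_neq0.
(* The only possible value: the average of [h] with weight [eta]. *)
pose c := Ih (fun x => h x * eta x) / Ih eta.
exists c.
have Lhc : L1 (fun x => h x - c) by apply: L1B => //; exact: L1_cst.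
suff : {ae mu, forall x, Ihalf x -> h x - c = 0}.
  apply: ae_imp => x H /H /eqP; rewrite /h subr_eq0 => /eqP <-.
  by rewrite subrK.
apply: fundamental_lemma => // phi tphi.
pose k := Ih phi / Ih eta.
have tth := test_funBZ k tphi teta.
have Lphi := test_fun_L1 tphi; have Leta := test_fun_L1 teta.
have I0 : Ih (fun x => phi x - k * eta x) = 0.
  by rewrite IhB ?IhZ//; [rewrite /k divfK// subrr|exact: L1Z].
have tp := test_fun_prim tth I0.
have := h0 _ tp.
have -> : derive1 (prim (fun x => phi x - k * eta x)) = (fun x => phi x - k * eta x).
  apply/funext => x; rewrite derive1E; apply: derive_val; apply: is_derive_prim.
  - exact: test_fun_L1.
  - exact: test_fun_continuous.
  - by move=> y; exact: (test_fun_out tth).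
have -> : Ih (fun x => h x * (phi x - k * eta x)) =
  Ih (fun x => h x * phi x) - k * Ih (fun x => h x * eta x).
  rewrite -IhZ; last exact: L1_test.
  rewrite -IhB; [|exact: L1_test|by apply: L1Z; exact: L1_test].
  by apply: Ih_eq => x _; rewrite mulrBr mulrCA.
move=> Z; transitivity (Ih (fun x => h x * phi x - c * phi x)).
  by apply: Ih_eq => x _; rewrite mulrBl.
rewrite IhB; [|exact: L1_test|exact: L1Z].
rewrite IhZ// -[RHS]Z /c /k; congr (_ - _).
by field.
Qed.

End DuBoisReymond.

(** * Sobolev spaces *)

Section Hspaces.
Context {R : realType}.
Notation mu := (@lebesgue_measure R).
Implicit Types (f g : R -> R) (s sigma : R).
Local Notation mI := (@measurable_Ihalf R).

Lemma sq_intP f : sq_int f <-> measurable_fun Ihalf f /\ L1 (fun x => f x ^+ 2).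
Proof.
have E : (\int[mu]_(x in Ihalf) `|(f x ^+ 2)%:E| = \int[mu]_(x in Ihalf) (f x ^+ 2)%:E)%E.
  by apply: eq_integral => x _; rewrite gee0_abs// lee_fin sqr_ge0.
split=> -[mf H]; split => //.
  apply/integrableP; split; last by rewrite E.
  by apply/measurable_EFinP; exact: measurable_funX.
by move/integrableP : H => [_]; rewrite /comp E.
Qed.

Lemma sq_int_L1sq f : sq_int f -> L1 (fun x => f x ^+ 2).
Proof. by move=> /sq_intP[]. Qed.

Lemma sq_int_mul f g : sq_int f -> sq_int g -> L1 (fun x => f x * g x).
Proof.
move=> /sq_intP[mf f2] /sq_intP[mg g2].
apply: (@L1_le _ _ (fun x => f x ^+ 2 + g x ^+ 2)).
- exact: measurable_funM.
- move=> x _; rewrite (@ger0_norm _ (_ + _)) ?addr_ge0 ?sqr_ge0//.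
  by rewrite ler_norml; apply/andP; split; nra.
- exact: L1D.
Qed.

Lemma sq_int_cst (c : R) : sq_int (fun=> c).
Proof. by apply/sq_intP; split => //; exact: L1_cst. Qed.

Lemma sq_int_L1 f : sq_int f -> L1 f.
Proof.
move=> sf; apply: L1_eq (sq_int_mul (sq_int_cst 1) sf).
by move=> x _; rewrite mul1r.
Qed.

Lemma sq_int_lin (a b : R) f g : sq_int f -> sq_int g ->
  sq_int (fun x => a * f x + b * g x).
Proof.
move=> sf sg; have Lfg := sq_int_mul sf sg.
move: sf sg => /sq_intP[mf f2] /sq_intP[mg g2]; apply/sq_intP; split.
  by apply: measurable_funD; apply: measurable_funM.
apply: (@L1_eq _ (fun x => a ^+ 2 * f x ^+ 2 + (b ^+ 2 * g x ^+ 2 + (2 * a * b) * (f x * g x)))).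
  by move=> x _; ring.
by apply: L1D; [exact: L1Z|apply: L1D; exact: L1Z].
Qed.

Lemma L2sqE f : sq_int f -> L2sq f = (Ih (fun x => f x ^+ 2))%:E.
Proof. by move=> /sq_int_L1sq; exact: Ih_fin. Qed.

Lemma sq_int_ae f g : measurable_fun Ihalf g ->
  {ae mu, forall x, Ihalf x -> f x = g x} -> sq_int f -> sq_int g.
Proof.
move=> mg fg /sq_intP[mf f2]; apply/sq_intP; split => //.
apply: L1_ae f2; first exact: measurable_funX.
by apply: ae_imp fg => x h /h ->.
Qed.

Lemma weak_deriv_lin (a b : R) f f' g g' : weak_deriv f f' -> weak_deriv g g' ->
  weak_deriv (fun x => a * f x + b * g x) (fun x => a * f' x + b * g' x).
Proof.
move=> [Lf [Lf' ff']] [Lg [Lg' gg']].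
split; first by apply: L1D; exact: L1Z.
split; first by apply: L1D; exact: L1Z.
move=> phi tphi; have tphi' := test_fun_derive tphi.
have key h k psi : L1 h -> L1 k -> test_fun psi ->
    Ih (fun x => (a * h x + b * k x) * psi x) =
    a * Ih (fun x => h x * psi x) + b * Ih (fun x => k x * psi x).
  move=> Lh Lk tpsi; rewrite -!IhZ; [|exact: L1_test..].
  rewrite -IhD; [|by apply: L1Z; exact: L1_test..].
  by apply: Ih_eq => x _; rewrite mulrDl !mulrA.
rewrite -!/(Ih _) !key// [Ih (fun x => f x * _)]ff'// [Ih (fun x => g x * _)]gg'//.
by rewrite !mulrN opprD.
Qed.

(** The Gagliardo integrand extended to the plane, so that Tonelli yields measurability of the inner
    integral. The indicator restricts the second variable only; the outer integral over [Ihalf]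
    restricts the first. *)
Definition gag_ker sigma f (z : measurableTypeR R * measurableTypeR R) : \bar R :=
  ((((f \_ Ihalf) z.1 - (f \_ Ihalf) z.2) ^+ 2 / (`|z.1 - z.2| `^ (1 + 2 * sigma)))
    * \1_Ihalf z.2)%:E.

Lemma measurable_gag_ker sigma f : measurable_fun Ihalf f ->
  measurable_fun setT (gag_ker sigma f).
Proof.
move=> mf.
have mf0 : measurable_fun [set: measurableTypeR R] (f \_ Ihalf).
  by apply/(measurable_restrictT _ _).1; first exact: mI.
apply/measurable_EFinP; apply: measurable_funM; last first.
  have m1 : measurable_fun [set: measurableTypeR R] (\1_Ihalf : R -> R).
    by apply: measurable_indic; exact: mI.
  exact: (measurableT_comp m1 measurable_snd).
apply: measurable_funM.
  by apply: measurable_funX; apply: measurable_funB; apply: measurableT_comp.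
under eq_fun do rewrite -powRN.
apply: (measurableT_comp (measurable_powR _)).
by apply: measurableT_comp => //; apply: measurable_funB.
Qed.

Lemma gag_ker_ge0 sigma f z : (0 <= gag_ker sigma f z)%E.
Proof. by rewrite lee_fin mulr_ge0// ?divr_ge0 ?sqr_ge0 ?powR_ge0. Qed.

Lemma gagliardoE sigma f :
  gagliardo sigma f = (\int[mu]_(x in Ihalf) \int[mu]_y gag_ker sigma f (x, y))%E.
Proof.
apply: eq_integral => x xI; rewrite integral_mkcond; apply: eq_integral => y _.
rewrite /gag_ker/= !patchE xI indicE; case: ifPn => yI /=; last by rewrite mulr0.
by rewrite mulr1.
Qed.

(** Pointwise on kernels, [(a X + b Y)^2 <= 2 a^2 X^2 + 2 b^2 Y^2], where [X] and [Y] are the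
    increments of [f] and [g]. *)
Lemma gagliardo_lin sigma (a b : R) f g : measurable_fun Ihalf f -> measurable_fun Ihalf g ->
  (gagliardo sigma f < +oo)%E -> (gagliardo sigma g < +oo)%E ->
  (gagliardo sigma (fun x => a * f x + b * g x)%R < +oo)%E.
Proof.
move=> mf mg; rewrite !gagliardoE => f1 g1.
have mh : measurable_fun Ihalf (fun x => a * f x + b * g x).
  by apply: measurable_funD; apply: measurable_funM.
have P z : ((fun x => a * f x + b * g x) \_ Ihalf) z = a * (f \_ Ihalf) z + b * (g \_ Ihalf) z.
  by rewrite !patchE; case: ifP => // _; rewrite !mulr0 addr0.
pose F h := fun x => (\int[mu]_y gag_ker sigma h (x, y))%E.
have mF h : measurable_fun Ihalf h -> measurable_fun setT (F h).
  move=> m; apply: (measurable_fun_fubini_tonelli_F (gag_ker sigma h)).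
    exact: measurable_gag_ker.
  by move=> z; exact: gag_ker_ge0.
have F0 h x : (0 <= F h x)%E by apply: integral_ge0 => y _; exact: gag_ker_ge0.
have mK h x : measurable_fun Ihalf h -> measurable_fun setT (fun y => gag_ker sigma h (x, y)).
  by move=> m; apply: measurableT_comp; first exact: measurable_gag_ker.
have a2 : 0 <= 2 * a ^+ 2 by rewrite mulr_ge0 ?sqr_ge0.
have b2 : 0 <= 2 * b ^+ 2 by rewrite mulr_ge0 ?sqr_ge0.
apply: (@le_lt_trans _ _ (\int[mu]_(x in Ihalf)
    ((2 * a ^+ 2)%:E * F f x + (2 * b ^+ 2)%:E * F g x))%E).
  apply: ge0_le_integral.
  - exact: mI.
  - by move=> x _; exact: F0.
  - by apply: measurable_funTS; exact: mF.
  - apply: emeasurable_funD; apply: measurable_funeM; apply: measurable_funTS; exact: mF.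
  - move=> x _; rewrite /F -!ge0_integralZl//; try exact: mK.
    + rewrite -ge0_integralD//.
      * apply: ge0_le_integral => //.
        - by move=> y _; exact: gag_ker_ge0.
        - exact: mK.
        - by apply: emeasurable_funD; apply: measurable_funeM; exact: mK.
        - move=> y _; rewrite /gag_ker/= -!EFinM -EFinD lee_fin.
          rewrite !mulrA -mulrDl ler_wpM2r// -mulrDl ler_wpM2r ?invr_ge0 ?powR_ge0//.
          rewrite !P; set fx := (f \_ _) x; set fy := (f \_ _) y.
          set gx := (g \_ _) x; set gy := (g \_ _) y.
          by have := sqr_ge0 (a * (fx - fy) - b * (gx - gy)); lra.
      * by move=> y _; rewrite mule_ge0 ?gag_ker_ge0.
      * by apply: measurable_funeM; exact: mK.
      * by move=> y _; rewrite mule_ge0 ?gag_ker_ge0.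
      * by apply: measurable_funeM; exact: mK.
    + by move=> y _; exact: gag_ker_ge0.
    + by move=> y _; exact: gag_ker_ge0.
rewrite ge0_integralD//.
- rewrite !ge0_integralZl//; try exact: mI; try (by apply: measurable_funTS; exact: mF).
  by rewrite lte_add_pinfty// lte_mul_pinfty.
- exact: mI.
- by move=> x _; rewrite mule_ge0.
- by apply: measurable_funeM; apply: measurable_funTS; exact: mF.
- by move=> x _; rewrite mule_ge0.
- by apply: measurable_funeM; apply: measurable_funTS; exact: mF.
Qed.

Lemma Hderivs_lin s (a b : R) f g d e :
  Hderivs s f d -> Hderivs s g e ->
  Hderivs s (fun x => a * f x + b * g x) (fun j x => a * d j x + b * e j x).
Proof.
move=> [d0 [sd [wd gd]]] [e0 [se [we ge]]].
split; first by rewrite d0 e0.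
split; first by move=> j js; apply: sq_int_lin; [exact: sd|exact: se].
split; first by move=> j js; apply: weak_deriv_lin => //; [exact: wd|exact: we].
move=> ts; apply: gagliardo_lin; [exact: (sd _ _).1|exact: (se _ _).1|exact: gd|exact: ge].
Qed.

Lemma gagliardo_ge0 sigma f : (0 <= gagliardo sigma f)%E.
Proof.
apply: integral_ge0 => x _; apply: integral_ge0 => y _.
by rewrite lee_fin divr_ge0 ?sqr_ge0 ?powR_ge0.
Qed.

(** Opens the choice inside [Hnorm]: on H^s the chosen family is a genuine one and its [Hsq] is
    finite, so [fine] and the square root lose nothing. *)
Lemma Hnorm_spec s f : inH s f -> exists2 d, Hderivs s f d &
  0 <= Hnorm s f /\ (Hsq s d = (Hnorm s f ^+ 2)%:E)%E.
Proof.
move=> [s0 ex]; pose D := epsilon (inhabits (fun _ _ => 0)) (Hderivs s f).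
have HD : Hderivs s f D by exact: epsilon_spec.
exists D => //; rewrite sqrtr_ge0; split => //.
have [_ [sD [_ gD]]] := HD.
have H0 : (0 <= Hsq s D)%E.
  apply: adde_ge0; last by case: ifP => // _; exact: gagliardo_ge0.
  apply: sume_ge0 => j _; apply: integral_ge0 => x _.
  by rewrite lee_fin sqr_ge0.
have Hfin : (Hsq s D \is a fin_num)%E.
  rewrite ge0_fin_numE// /Hsq; apply: lte_add_pinfty.
    by apply: lte_sum_pinfty => j _; apply: (sD j _).2; rewrite -ltnS.
  by case: ifP => // h; exact: gD.
rewrite /Hnorm sqr_sqrtr -/D; first by rewrite fineK.
exact: fine_ge0.
Qed.

Lemma Hnorm_component s f d j : Hderivs s f d -> Hsq s d = (Hnorm s f ^+ 2)%:E ->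
  (j <= Num.truncn s)%N -> Ih (fun x => d j x ^+ 2) <= Hnorm s f ^+ 2.
Proof.
move=> [_ [sd _]] E js; rewrite -lee_fin -E -L2sqE; last exact: sd.
have js' : (j < (Num.truncn s).+1)%N by [].
rewrite /Hsq (bigD1 (Ordinal js'))//= -addeA leeDl// adde_ge0//.
  by apply: sume_ge0 => k _; apply: integral_ge0 => x _; rewrite lee_fin sqr_ge0.
by case: ifP => // _; exact: gagliardo_ge0.
Qed.

End Hspaces.

(** * Weak derivatives and the energy identity *)

Section WeakDerivatives.
Context {R : realType}.
Notation mu := (@lebesgue_measure R).
Implicit Types (f g : R -> R).

(** Reconciles the derivatives picked by [Hnorm], those given by membership in H^s and those
    appearing in the equations. *)
Lemma weak_deriv_unique f1 f2 g1 g2 : weak_deriv f1 g1 -> weak_deriv f2 g2 ->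
  {ae mu, forall x, Ihalf x -> f1 x = f2 x} ->
  {ae mu, forall x, Ihalf x -> g1 x = g2 x}.
Proof.
move=> [Lf1 [Lg1 H1]] [Lf2 [Lg2 H2]] f12.
suff : {ae mu, forall x, Ihalf x -> g1 x - g2 x = 0}.
  by apply: ae_imp => x h /h /eqP; rewrite subr_eq0 => /eqP.
apply: fundamental_lemma; first exact: L1B.
move=> phi tphi; have tphi' := test_fun_derive tphi.
transitivity (Ih (fun x => g1 x * phi x - g2 x * phi x)).
  by apply: Ih_eq => x _; rewrite mulrBl.
rewrite IhB; [|exact: L1_test..].
apply/eqP; rewrite subr_eq0 -eqr_opp; apply/eqP.
rewrite -[LHS]H1// -[RHS]H2//; apply: Ih_ae.
- by apply: L1_measurable; exact: L1_test.
- by apply: L1_measurable; exact: L1_test.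
- by apply: ae_imp f12 => x h /h ->.
Qed.

(** * Continuous representatives and boundary values *)

Lemma ae_exists_itv (P : R -> Prop) (a b : R) : a < b ->
  {ae mu, forall x, P x} -> exists2 x, a < x < b & P x.
Proof.
move=> ab [A [mA A0 sub]]; apply: contrapT => N.
have : (mu `]a, b[%classic <= mu A)%E.
  apply: le_measure; rewrite ?inE//.
  move=> x; rewrite /= in_itv/= => xab; apply: sub => /= Px.
  by apply: N; exists x.
rewrite A0 lebesgue_measure_itv/= lte_fin ab -EFinD lee_fin.
by rewrite subr_le0 leNgt ab.
Qed.

Lemma within_Ihalfc_near f (x e : R) : {within Ihalfc, continuous f} -> Ihalfc x -> 0 < e ->
  exists2 d : R, 0 < d & forall y, Ihalfc y -> `|x - y| < d -> `|f x - f y| < e.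
Proof.
move=> /subspace_continuousP cf Ix e0.
have /cvgrPdist_lt/(_ _ e0) := cf x Ix.
by move=> [d /= d0 H]; exists d => // y Iy xy; exact: H.
Qed.

(** Du Bois-Reymond gives [f = c + prim g] almost everywhere; continuity of both sides extends it to
    every point of the closed interval, and the value at 0 forces [c = 0]. *)
Lemma weak_deriv_primE f g : {within Ihalfc, continuous f} -> weak_deriv f g ->
  f 0 = 0 -> forall x, Ihalfc x -> f x = prim g x.
Proof.
move=> cf wfg f00.
have [c Hc] := du_bois_reymond wfg.
have Lg := wfg.2.1.
have key x : Ihalfc x -> f x = c + prim g x.
  move=> Ix; apply/eqP; rewrite -subr_eq0 -normr_le0; apply/ler_addgt0Pr => e e0.
  have e2 : 0 < e / 2 by rewrite divr_gt0.
  have [d1 d10 H1] := within_Ihalfc_near cf Ix e2.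
  have [d2 d20 H2] := prim_unif Lg e2.
  (* The cap at a quarter, half the length of the interval, leaves room for an interval of length
     [d] on one side of [x]. *)
  pose d := Num.min (Num.min d1 d2) 4^-1.
  have d0 : 0 < d by rewrite !lt_min d10 d20 invr_gt0 ltr0n.
  have dd1 : d <= d1 by rewrite !ge_min lexx.
  have dd2 : d <= d2 by rewrite !ge_min lexx orbT.
  have d4 : d <= 4^-1 by rewrite !ge_min lexx orbT.
  have [a [b [ab [aI [bI near]]]]] : exists a b : R, a < b /\ 0 <= a /\ b <= 2^-1 /\
      (forall y, a < y < b -> `|x - y| < d).
    move: Ix; rewrite /Ihalfc/= => /andP[x0 x2].
    have [x4|x4] := leP x 4^-1.
      exists x, (x + d); split; first by rewrite ltrDl.
      split => //; split; first by lra.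
      by move=> y /andP[xy yx]; rewrite ltr_norml; lra.
    exists (x - d), x; split; first by rewrite ltrBlDr ltrDl.
    split; first by lra.
    split => // y /andP[xy yx]; rewrite ltr_norml; lra.
  have [y /andP[ay yb] Hy] := ae_exists_itv ab Hc.
  have Iy : Ihalf y by rewrite /Ihalf/= (le_lt_trans aI ay) (lt_le_trans yb bI).
  have Iyc : Ihalfc y by rewrite /Ihalfc/= (ltW (le_lt_trans aI ay)) (ltW (lt_le_trans yb bI)).
  have xyd : `|x - y| < d by apply: near; rewrite ay yb.
  have E1 := H1 y Iyc (lt_le_trans xyd dd1).
  have E2 := H2 x y (lt_le_trans xyd dd2).
  have E3 := Hy Iy.
  rewrite add0r.
  have -> : f x - (c + prim g x) = (f x - f y) - (prim g x - prim g y) by rewrite E3; ring.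
  rewrite (le_trans (ler_normB _ _))// [e]splitr lerD// ltW//.
have I0 : Ihalfc (0 : R) by rewrite /Ihalfc/= lexx/= invr_ge0 ler0n.
have := key 0 I0; rewrite f00 prim_le0// addr0 => c0 x Ix.
by rewrite key// -c0 add0r.
Qed.

(** Applied to [u], this removes the du Bois-Reymond constant and the right-hand side of
    [prim_by_parts] in the energy identity. *)
Lemma weak_deriv_Ih0 f g : {within Ihalfc, continuous f} -> weak_deriv f g ->
  f 0 = 0 -> f 2^-1 = 0 -> Ih g = 0.
Proof.
move=> cf wfg f0 f2; rewrite -(@prim_ge_half _ g 2^-1)//.
by rewrite -(weak_deriv_primE cf wfg f0)// /Ihalfc/= lexx invr_ge0 ler0n.
Qed.

(** Integration by parts of [cut g x] against itself, its full integral being [prim g x]. *)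
Lemma prim_sqr g x : L1 g -> prim (fun y => 2 * (prim g y * g y)) x = prim g x ^+ 2.
Proof.
move=> Lg.
have Lc := L1_cut x Lg.
have := prim_by_parts Lc Lc; rewrite -expr2 => <-.
rewrite -[X in X + _]mul1r -[X in _ + X]mul1r -mulrDl -[1 + 1]/(2 : R) -IhZ; last exact: L1_mul_prim.
apply: Ih_eq => y _; rewrite /cut; case: ifPn => yx; last by rewrite mul0r mulr0.
congr (_ * _); rewrite mulrC; congr (_ * _); apply: Ih_eq => z _; rewrite /cut.
by case: ifP => // zy; rewrite (lt_trans zy yx).
Qed.

Lemma energy_identity (kappa : R) (u rho ut rhot ux uxx rhox utx : R -> R) :
  weak_deriv u ux -> weak_deriv ux uxx -> weak_deriv rho rhox -> weak_deriv ut utx ->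
  sq_int ux -> sq_int uxx -> sq_int rho -> sq_int rhox -> sq_int utx -> sq_int rhot ->
  {within Ihalfc, continuous u} -> {within Ihalfc, continuous rho} ->
  u 0 = 0 -> rho 0 = 0 -> u 2^-1 = 0 ->
  (forall phi, test_fun phi ->
    - Rintegral mu Ihalf (fun x => ut x * derive1 (derive1 phi) x) =
      - Rintegral mu Ihalf (fun x => u x * uxx x * derive1 phi x)
      + Rintegral mu Ihalf (fun x => ux x * uxx x * phi x)
      - kappa * Rintegral mu Ihalf (fun x => rho x * rhox x * phi x)) ->
  (\forall x \ae mu, Ihalf x -> rhot x = - (rhox x * u x + rho x * ux x)) ->
  Ih (fun x => ux x * utx x) + kappa * Ih (fun x => rho x * rhot x) = 0.
Proof.
move=> wu wux wrho wut sux suxx srho srhox sutx srhot cu cr u0 r0 u2 mom trans.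
have [Lu [Lux _]] := wu; have [_ [Luxx _]] := wux.
have [Lrho [Lrhox _]] := wrho; have [Lut [Lutx Hut]] := wut.
have uE := weak_deriv_primE cu wu u0.
have rE := weak_deriv_primE cr wrho r0.
have Iux := weak_deriv_Ih0 cu wu u0 u2.
have Ic x : Ihalf x -> Ihalfc x by move=> /andP[h1 h2]; rewrite /Ihalfc/= !ltW.
pose U := prim ux; pose P := prim rhox.
have UE x : Ihalf x -> u x = U x by move=> /Ic; exact: uE.
have PE x : Ihalf x -> rho x = P x by move=> /Ic; exact: rE.
have bU g : L1 g -> L1 (fun x => u x * g x).
  move=> Lg; apply: L1_eq (L1_mul_prim Lg Lux) => x Ix.
  by rewrite -/U -UE// mulrC.
have L1uu := sq_int_mul sux suxx.
have L1rr := sq_int_mul srho srhox.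
pose F x := utx x + u x * uxx x.
pose G x := ux x * uxx x - kappa * (rho x * rhox x).
have LF : L1 F by apply: L1D => //; exact: bU.
have LG : L1 G by apply: L1B => //; exact: L1Z.
have wF : weak_deriv F (fun x => - G x).
  split => //; split; first exact: L1N.
  move=> phi tphi; rewrite -!/(Ih _); have tphi' := test_fun_derive tphi.
  (* Testing the weak derivative of [ut] with [phi'] lowers [phi''] to [phi'], so the momentum
     equation becomes a first-order relation for [F]. *)
  have := mom _ tphi; rewrite -!/(Ih _) [Ih (fun x => ut x * _)](Hut _ tphi') opprK -/(Ih _) => M.
  transitivity (Ih (fun x => utx x * derive1 phi x) + Ih (fun x => u x * uxx x * derive1 phi x)).
    rewrite -IhD; [|exact: L1_test|by apply: L1_test => //; exact: bU].
    by apply: Ih_eq => x _; rewrite mulrDl.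
  rewrite M addrAC -addrA addrACA.
  transitivity (Ih (fun x => G x * phi x)); last first.
    rewrite -IhN; last by apply: L1_test => //; exact: L1N.
    by apply: Ih_eq => x _; rewrite mulNr opprK.
  transitivity (Ih (fun x => ux x * uxx x * phi x) - kappa * Ih (fun x => rho x * rhox x * phi x)).
    ring.
  rewrite -IhZ; last exact: L1_test.
  rewrite -IhB; [|exact: L1_test|by apply: L1Z; exact: L1_test].
  by apply: Ih_eq => x _; rewrite /G mulrBl mulrA.
have [c Fc] := du_bois_reymond wF.
have LNG := L1N LG.
have LFux : L1 (fun x => F x * ux x).
  apply: (@L1_eq _ (fun x => utx x * ux x + u x * (ux x * uxx x))).
    by move=> x _; rewrite /F; ring.
  by apply: L1D; [exact: sq_int_mul|exact: bU].
have LuG : L1 (fun x => u x * G x) by exact: bU.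
(* Substitute [F = c + prim (- G)]: [c] is multiplied by the zero mean of [ux], and the rest is
   integrated by parts with [u = prim ux]. *)
have I1 : Ih (fun x => F x * ux x) = Ih (fun x => u x * G x).
  transitivity (Ih (fun x => c * ux x + ux x * prim (fun x => - G x) x)).
    apply: Ih_ae.
    - exact: L1_measurable.
    - by apply: L1_measurable; apply: L1D; [exact: L1Z|exact: L1_mul_prim].
    - by apply: ae_imp Fc => x h /h ->; ring.
  rewrite IhD; [|exact: L1Z|exact: L1_mul_prim].
  rewrite IhZ// Iux mulr0 add0r.
  have := prim_by_parts Lux LNG; rewrite Iux mul0r => /eqP; rewrite addr_eq0 => /eqP ->.
  rewrite -IhN; last exact: L1_mul_prim.
  by apply: Ih_eq => x Ix; rewrite -/U -UE//; ring.
(* The integral of [u ux uxx] occurs on both sides of [I1] and cancels. *)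
have I2 : Ih (fun x => ux x * utx x) = - kappa * Ih (fun x => u x * (rho x * rhox x)).
  have L3 : L1 (fun x => u x * (ux x * uxx x)) by exact: bU.
  have L4 : L1 (fun x => u x * (rho x * rhox x)) by exact: bU.
  have : Ih (fun x => F x * ux x) = Ih (fun x => ux x * utx x) + Ih (fun x => u x * (ux x * uxx x)).
    rewrite -IhD//; last exact: sq_int_mul.
    by apply: Ih_eq => x _; rewrite /F; ring.
  have : Ih (fun x => u x * G x) = Ih (fun x => u x * (ux x * uxx x)) - kappa * Ih (fun x => u x * (rho x * rhox x)).
    rewrite -IhZ// -IhB//; last exact: L1Z.
    by apply: Ih_eq => x _; rewrite /G; ring.
  by rewrite I1; lra.
have Lrr2 : L1 (fun x => 2 * (P x * rhox x)).
  apply: (@L1_eq _ (fun x => 2 * (rho x * rhox x))).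
    by move=> x Ix; rewrite PE.
  exact: L1Z.
have Lp2 : L1 (fun x => P x * (P x * ux x)).
  have h g : L1 g -> L1 (fun x => P x * g x).
    move=> Lg; apply: L1_eq (L1_mul_prim Lg Lrhox) => x _.
    by rewrite mulrC.
  exact: h (h _ Lux).
(* Writing [A] for the right-hand side, transport gives [- A] minus the integral of [rho^2 ux];
   since [rho^2] is the primitive of [2 rho rhox], that integral is [- 2 A]. *)
have I3 : Ih (fun x => rho x * rhot x) = Ih (fun x => u x * (rho x * rhox x)).
  have L4 : L1 (fun x => u x * (rho x * rhox x)) by exact: bU.
  transitivity (Ih (fun x => - (u x * (rho x * rhox x) + P x * (P x * ux x)))).
    apply: Ih_ae.
    - by apply: L1_measurable; exact: sq_int_mul.
    - by apply: L1_measurable; apply: L1N; exact: L1D.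
    - by apply: ae_imp trans => x h Ix; rewrite (h Ix) -PE//; ring.
  rewrite IhN; last exact: L1D.
  rewrite IhD//.
  have := prim_by_parts Lux Lrr2; rewrite Iux mul0r.
  have -> : Ih (fun x => ux x * prim (fun y => 2 * (P y * rhox y)) x) = Ih (fun x => P x * (P x * ux x)).
    by apply: Ih_eq => x _; rewrite prim_sqr// -/P; ring.
  have -> : Ih (fun x => 2 * (P x * rhox x) * prim ux x) = 2 * Ih (fun x => u x * (rho x * rhox x)).
    by rewrite -IhZ//; apply: Ih_eq => x Ix; rewrite -/U -UE// -PE//; ring.
  by lra.
rewrite I2 I3; ring.
Qed.

End WeakDerivatives.

(** * Differentiation in time *)

Section TimeDerivative.
Context {R : realType}.
Notation mu := (@lebesgue_measure R).

(* The quotients are restricted to [[0, T)], so at [t = 0] this is one-sided. *)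
Definition time_diff (T : \bar R) (E : R -> R) (t l : R) : Prop :=
  forall e : R, 0 < e -> exists2 d : R, 0 < d & forall t', 0 <= t' -> (t'%:E < T)%E ->
    t' != t -> `|t' - t| < d -> `|(E t' - E t) / (t' - t) - l| < e.

Lemma time_diffDZ (T : \bar R) (c : R) E F t l m : time_diff T E t l -> time_diff T F t m ->
  time_diff T (fun t => E t + c * F t) t (l + c * m).
Proof.
move=> dE dF e e0.
have e2 : 0 < e / 2 by rewrite divr_gt0.
have ec : 0 < e / 2 / (`|c| + 1) by rewrite divr_gt0// ltr_wpDl.
have [d1 d10 H1] := dE _ e2; have [d2 d20 H2] := dF _ ec.
exists (Num.min d1 d2); first by rewrite lt_min d10.
move=> t' t0 tT tt; rewrite lt_min => /andP[h1 h2].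
have := H1 _ t0 tT tt h1; have := H2 _ t0 tT tt h2.
rewrite ltr_pdivlMr ?ltr_wpDl// => A B.
have -> : (E t' + c * F t' - (E t + c * F t)) / (t' - t) - (l + c * m) =
  ((E t' - E t) / (t' - t) - l) + c * ((F t' - F t) / (t' - t) - m) by ring.
apply: (le_lt_trans (ler_normD _ _)); rewrite [e]splitr ltr_leD// normrM.
apply: le_trans (ltW A); rewrite mulrC ler_wpM2l// lerDl//.
Qed.

(** Mean value theorem on [[0, t]]: the one-sided quotient at 0 is used only for continuity there,
    while the vanishing derivative is used in the open interval. *)
Lemma time_diff_cst (T : \bar R) (E l : R -> R) :
  (forall t, 0 <= t -> (t%:E < T)%E -> time_diff T E t (l t)) ->
  (forall t, 0 < t -> (t%:E < T)%E -> l t = 0) ->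
  forall t, 0 <= t -> (t%:E < T)%E -> E t = E 0.
Proof.
move=> dE l0 t; rewrite le_eqVlt => /orP[/eqP <-//|t0] tT.
(* Constant continuation to the left of 0, so that plain continuity at 0 can be used. *)
pose F x := E (Num.max 0 x).
have F0 : F 0 = E 0 by rewrite /F maxxx.
have Ft : F t = E t by rewrite /F max_r// ltW.
have [||c _] := @MVT R F (fun=> 0) 0 t t0; last first.
- by rewrite mul0r F0 Ft => /eqP; rewrite subr_eq0 => /eqP.
- apply: continuous_in_subspaceT => x; rewrite inE/= in_itv/= => /andP[x0 xt].
  have xT : (x%:E < T)%E by apply: le_lt_trans tT; rewrite lee_fin.
  have [d1 d10 H] := dE x x0 xT 1 ltr01.
  apply/cvgrPdist_lt => /= e e0.
  (* Near [x] the difference quotients of [E] are within 1 of [l x], hence bounded by [M]. *)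
  pose M := `|l x| + 1; have M0 : 0 < M by rewrite ltr_wpDl.
  have T' : exists2 d2, 0 < d2 & forall y, `|y - x| < d2 -> (y%:E < T)%E.
    case: T xT {dE l0 tT H} => [r| |]//=.
      rewrite lte_fin => xr; exists (r - x); first by rewrite subr_gt0.
      by move=> y; rewrite ltr_norml lte_fin => /andP[_]; rewrite ltrD2r.
    by move=> _; exists 1 => // y _; rewrite ltry.
  have [d2 d20 H2] := T'.
  exists (Num.min (Num.min d1 d2) (e / M)); first by rewrite /= !lt_min d10 d20 divr_gt0.
  move=> y /=; rewrite distrC !lt_min => /andP[/andP[y1 y2] y3].
  rewrite /F [Num.max 0 x]max_r//; set z := Num.max 0 y.
  have zx : `|z - x| <= `|y - x|.
    rewrite /z; have [y0|y0] := leP 0 y; first by rewrite lexx.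
    by rewrite sub0r normrN ger0_norm// ltr0_norm ?subr_lt0 ?(lt_le_trans y0)//; lra.
  have [->|zn] := eqVneq z x; first by rewrite subrr normr0.
  have := H z; rewrite le_max lexx => /(_ isT (H2 _ (le_lt_trans zx y2)) zn (le_lt_trans zx y1)).
  move=> Hz; rewrite distrC.
  have zx0 : z - x != 0 by rewrite subr_eq0.
  have -> : E z - E x = ((E z - E x) / (z - x) - l x + l x) * (z - x) by rewrite subrK divfK.
  rewrite normrM.
  have h1 : `|(E z - E x) / (z - x) - l x + l x| <= M.
    by rewrite (le_trans (ler_normD _ _))// addrC lerD2l ltW.
  apply: (@le_lt_trans _ _ (M * `|y - x|)); first by rewrite ler_pM.
  by rewrite mulrC -ltr_pdivlMr.
- move=> x; rewrite in_itv/= => /andP[x0 xt].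
  have xT : (x%:E < T)%E by apply: lt_trans tT; rewrite lte_fin.
  have := dE x (ltW x0) xT; rewrite (l0 x)// => D.
  have L : h^-1 *: (F (h *: 1 + x) - F x) @[h --> 0^'] --> (0 : R).
    apply/cvgr0Pnorm_lt => e e0.
    have [d d0 H] := D e e0.
    near=> h.
    have h0 : h != 0 by near: h; exact: nbhs_dnbhs_neq.
    have hd : `|h| < d by near: h; exact: dnbhs0_lt.
    have hx : `|h| < x by near: h; exact: dnbhs0_lt.
    have ht : `|h| < t - x by near: h; apply: dnbhs0_lt; rewrite subr_gt0.
    have p0 : 0 <= h + x by move: hx; rewrite ltr_norml => /andP[]; lra.
    have pt : h + x < t by move: ht; rewrite ltr_norml => /andP[]; lra.
    rewrite /F [h *: 1]mulr1 !max_r//; last exact: ltW.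
    have := H (h + x) p0; rewrite subr0 addrK => /(_ _ _ hd).
    rewrite -subr_eq0 addrK => /(_ (lt_trans _ tT) h0).
    by rewrite lte_fin mulrC; apply.
  apply: DeriveDef; first by apply/cvg_ex; exists 0.
  exact: cvg_lim L.
Unshelve. all: by end_near. Qed.

(** With [h = t' - t] and [r] the quotient of [w] minus [z], the quotient of [w^2] minus [2 w z]
    equals [2 w r + h (r + z)^2]. The first term is split with a weight [d], the second carries the
    small factor [h]. *)
Lemma time_diff_L2sq (T : \bar R) (w : R -> R -> R) (z : R -> R) (t : R) :
  0 <= t -> (t%:E < T)%E ->
  (forall t', 0 <= t' -> (t'%:E < T)%E -> sq_int (w t')) -> sq_int z ->
  (forall e : R, 0 < e -> exists2 d : R, 0 < d & forall t', 0 <= t' -> (t'%:E < T)%E ->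
    t' != t -> `|t' - t| < d ->
    Ih (fun x => ((w t' x - w t x) / (t' - t) - z x) ^+ 2) < e ^+ 2) ->
  time_diff T (fun t => Ih (fun x => w t x ^+ 2)) t (2 * Ih (fun x => w t x * z x)).
Proof.
move=> t0 tT sw sz H e e0.
have swt := sw t t0 tT.
pose W := Ih (fun x => w t x ^+ 2); pose Z := Ih (fun x => z x ^+ 2).
have W0 : 0 <= W by apply: Ih_ge0 => x _; exact: sqr_ge0.
have Z0 : 0 <= Z by apply: Ih_ge0 => x _; exact: sqr_ge0.
(* Three errors get [e / 4] each: [d] controls [d w^2]; [e1^2 <= e1 <= e d / 4] controls [r^2 / d];
   the radius [e / (4 (2 + 2 Z))] controls the term with factor [|h|], as [r^2] has integral at most
   1. *)
pose d := e / (4 * (W + 1)).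
have d0 : 0 < d by rewrite divr_gt0// mulr_gt0// ltr_wpDl.
pose e1 := Num.min 1 (e * d / 4).
have e10 : 0 < e1 by rewrite lt_min ltr01 divr_gt0// mulr_gt0.
have [d1 d10 H1] := H _ e10.
exists (Num.min d1 (e / (4 * (2 + 2 * Z)))).
  by rewrite lt_min d10 divr_gt0// mulr_gt0// ltr_wpDr// mulr_ge0.
move=> t' t'0 t'T tt; rewrite lt_min => /andP[h1 h2].
have {H1} := H1 _ t'0 t'T tt h1.
set h := t' - t in h1 h2 *.
have hn0 : h != 0 by rewrite subr_eq0.
pose r x := (w t' x - w t x) / h - z x.
have sw' := sw t' t'0 t'T.
have sr : sq_int r.
  have := sq_int_lin 1 (-1) (sq_int_lin h^-1 (- h^-1) sw' swt) sz.
  congr sq_int; apply/funext => x; rewrite /r; ring.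
rewrite -/(r _) => rlt.
set Rr := Ih (fun x => r x ^+ 2) in rlt.
have Rr0 : 0 <= Rr by apply: Ih_ge0 => x _; exact: sqr_ge0.
have Lw2 := sq_int_L1sq swt; have Lw2' := sq_int_L1sq sw'.
have Lr2 := sq_int_L1sq sr; have Lz2 := sq_int_L1sq sz.
have Lwz := sq_int_mul swt sz.
have e11 : e1 ^+ 2 <= e1.
  by rewrite expr2 ler_piMl ?(ltW e10)// ge_min lexx.
have e1a : e1 <= 1 by rewrite ge_min lexx.
have e1b : e1 <= e * d / 4 by rewrite ge_min lexx orbT.
pose q x := (w t' x ^+ 2 - w t x ^+ 2) * h^-1 - 2 * (w t x * z x).
have Lq : L1 q.
  apply: L1B; last exact: L1Z.
  by apply: L1_eq (L1Z h^-1 (L1B Lw2' Lw2)) => x _; rewrite mulrC.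
have -> : (Ih (fun x => w t' x ^+ 2) - Ih (fun x => w t x ^+ 2)) / h - 2 * Ih (fun x => w t x * z x) = Ih q.
  rewrite /q IhB; last 2 first.
  - by apply: L1_eq (L1Z h^-1 (L1B Lw2' Lw2)) => x _; rewrite mulrC.
  - exact: L1Z.
  rewrite IhZ//; congr (_ - _).
  rewrite -IhB// mulrC -IhZ; last exact: L1B.
  by apply: Ih_eq => x _; rewrite mulrC.
pose B x := d * w t x ^+ 2 + (d^-1 * r x ^+ 2 + (`|h| * (2 * r x ^+ 2) + `|h| * (2 * z x ^+ 2))).
have LB : L1 B.
  apply: L1D; first exact: L1Z.
  apply: L1D; first exact: L1Z.
  by apply: L1D; apply: L1Z; exact: L1Z.
have IB : Ih B = d * W + (d^-1 * Rr + (`|h| * (2 * Rr) + `|h| * (2 * Z))).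
  rewrite /B IhD; [|exact: L1Z|by apply: L1D; [exact: L1Z|apply: L1D; apply: L1Z; exact: L1Z]].
  rewrite IhD; [|exact: L1Z|by apply: L1D; apply: L1Z; exact: L1Z].
  rewrite IhD; [|by apply: L1Z; exact: L1Z..].
  by rewrite !IhZ//; exact: L1Z.
have qB : `|Ih q| <= Ih B.
  apply: (le_trans (Ih_abs Lq)); apply: Ih_le => //; first exact: L1_abs.
  move=> x _.
  have -> : q x = 2 * w t x * r x + h * (r x + z x) ^+ 2.
    by rewrite /q /r; field.
  apply: (le_trans (ler_normD _ _)).
  rewrite /B addrA lerD//.
    (* AM-GM: [|2 w r| <= d w^2 + r^2 / d] *)
    have A1 : 0 <= d^-1 * (d * w t x - r x) ^+ 2 by rewrite mulr_ge0 ?sqr_ge0// invr_ge0 ltW.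
    have A2 : 0 <= d^-1 * (d * w t x + r x) ^+ 2 by rewrite mulr_ge0 ?sqr_ge0// invr_ge0 ltW.
    have dn0 : d != 0 by rewrite gt_eqF.
    have E1 : d^-1 * (d * w t x - r x) ^+ 2 = d * w t x ^+ 2 + d^-1 * r x ^+ 2 - 2 * w t x * r x by field.
    have E2 : d^-1 * (d * w t x + r x) ^+ 2 = d * w t x ^+ 2 + d^-1 * r x ^+ 2 + 2 * w t x * r x by field.
    by rewrite ler_norml; apply/andP; split; lra.
  rewrite normrM -mulrDr ler_wpM2l// ger0_norm ?sqr_ge0//.
  by have := sqr_ge0 (r x - z x); nra.
apply: (le_lt_trans qB); rewrite IB.
have T1 : d * W <= e / 4.
  rewrite /d -mulrA ler_wpM2l ?(ltW e0)// invfM -mulrA ler_piMr// ?invr_ge0//.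
  by rewrite ler_pdivrMl ?ltr_wpDl// mulr1 lerDl.
have T2 : d^-1 * Rr <= e / 4.
  rewrite ler_pdivrMl//; apply: (le_trans (ltW rlt)); apply: (le_trans e11).
  by apply: (le_trans e1b); rewrite -mulrA mulrCA.
have Rr1 : Rr <= 1 by apply: (le_trans (ltW rlt)); exact: le_trans e1a.
have T3 : `|h| * (2 * Rr) + `|h| * (2 * Z) <= e / 4.
  rewrite -mulrDr.
  apply: (@le_trans _ _ (`|h| * (2 + 2 * Z))).
    by rewrite ler_wpM2l// lerD2r ler_piMr.
  rewrite -ler_pdivlMr ?ltr_wpDr ?mulr_ge0//.
  by rewrite -mulrA -invfM; exact: ltW.
lra.
Qed.

End TimeDerivative.

(** * Norm estimates *)

Section Quotients.
Context {R : realType}.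
Notation mu := (@lebesgue_measure R).
Implicit Types (f g k : R -> R) (c s : R).

Lemma quot_lin f g k c :
  (fun x => (f x - g x) / c - k x) =
  (fun x => 1 * (c^-1 * f x + - c^-1 * g x) + -1 * k x).
Proof. by apply/funext => x; ring. Qed.

Lemma inH_quot s f g k c : inH s f -> inH s g -> inH s k ->
  inH s (fun x => (f x - g x) / c - k x).
Proof.
move=> [s0 [df hf]] [_ [dg hg]] [_ [dk hk]]; split => //.
rewrite quot_lin; eexists.
by apply: Hderivs_lin; [apply: Hderivs_lin; [exact: hf|exact: hg]|exact: hk].
Qed.

Lemma weak_deriv_quot f g k f' g' k' c :
  weak_deriv f f' -> weak_deriv g g' -> weak_deriv k k' ->
  weak_deriv (fun x => (f x - g x) / c - k x) (fun x => (f' x - g' x) / c - k' x).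
Proof.
move=> wf wg wk; rewrite !quot_lin.
by apply: weak_deriv_lin => //; exact: weak_deriv_lin.
Qed.

Lemma sq_int_quot f g k c : sq_int f -> sq_int g -> sq_int k ->
  sq_int (fun x => (f x - g x) / c - k x).
Proof.
by move=> sf sg sk; rewrite quot_lin; apply: sq_int_lin => //; exact: sq_int_lin.
Qed.

Lemma inH1P s f : Num.truncn s = 1%N -> inH s f ->
  exists f', [/\ weak_deriv f f', sq_int f & sq_int f'].
Proof.
move=> ts [_ [d [d0 [sd [wd _]]]]]; rewrite ts in sd wd.
exists (d 1%N); rewrite -d0; split; [exact: wd|exact: sd|exact: sd].
Qed.

Lemma inH2P s f : Num.truncn s = 2%N -> inH s f ->
  exists f' f'', [/\ weak_deriv f f', weak_deriv f' f'', sq_int f' & sq_int f''].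
Proof.
move=> ts [_ [d [d0 [sd [wd _]]]]]; rewrite ts in sd wd.
exists (d 1%N), (d 2%N); rewrite -d0; split; [exact: wd|exact: wd|exact: sd|exact: sd].
Qed.

(** The norm controls the derivative of its own family; uniqueness almost everywhere transfers the
    bound to [f']. *)
Lemma Hnorm1_deriv_lt s f f' (e : R) : Num.truncn s = 1%N -> inH s f -> weak_deriv f f' ->
  measurable_fun Ihalf f' -> Hnorm s f < e -> Ih (fun x => f' x ^+ 2) < e ^+ 2.
Proof.
move=> ts If wf mf' He.
have [d hd [H0 E]] := Hnorm_spec If.
have e0 : 0 < e by exact: le_lt_trans He.
apply: (@le_lt_trans _ _ (Hnorm s f ^+ 2)); last by rewrite ltr_pXn2r// nnegrE ltW.
have := @Hnorm_component _ _ _ _ 1%N hd E; rewrite ts => /(_ isT); apply: le_trans.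
have [d0 [sd [wd _]]] := hd; rewrite ts in sd wd.
have wd01 := wd 0%N isT; rewrite d0 in wd01.
have ae := weak_deriv_unique wf wd01 (aeW _ (fun x _ => erefl)).
rewrite le_eqVlt; apply/orP; left; apply/eqP; apply: Ih_ae.
- exact: measurable_funX.
- by apply: measurable_funX; exact: (sd 1%N isT).1.
- by apply: ae_imp ae => x h /h ->.
Qed.

Lemma Hnorm0_lt s f (e : R) : inH s f -> Hnorm s f < e -> Ih (fun x => f x ^+ 2) < e ^+ 2.
Proof.
move=> If He; have [d hd [H0 E]] := Hnorm_spec If.
have e0 : 0 < e by exact: le_lt_trans He.
apply: (@le_lt_trans _ _ (Hnorm s f ^+ 2)); last by rewrite ltr_pXn2r// nnegrE ltW.
by have := @Hnorm_component _ _ _ _ 0%N hd E (leq0n _); rewrite hd.1.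
Qed.

(** The sum of the two integrals is [N^2] for the norm [N], and [N <= 1 + N^2]. *)
Lemma Hnorm1_le f f' : weak_deriv f f' -> sq_int f -> sq_int f' ->
  Hnorm 1 f <= 1 + (Ih (fun x => f x ^+ 2) + Ih (fun x => f' x ^+ 2)).
Proof.
move=> wf sf sf'.
have If : inH 1 f.
  split => //; exists (fun j => if j is 0%N then f else f'); rewrite /Hderivs truncn1.
  by split => //; split; [case|split; [case|rewrite ltxx]].
have [d [d0 [sd [wd _]]] [H0 E]] := Hnorm_spec If.
rewrite truncn1 in sd wd.
have wd01 := wd 0%N isT; rewrite d0 in wd01.
have ae := weak_deriv_unique wf wd01 (aeW _ (fun x _ => erefl)).
have -> : Ih (fun x => f' x ^+ 2) = Ih (fun x => d 1%N x ^+ 2).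
  apply: Ih_ae.
  - by apply: measurable_funX; exact: sf'.1.
  - by apply: measurable_funX; exact: (sd 1%N isT).1.
  - by apply: ae_imp ae => x h /h ->.
move: E; rewrite /Hsq truncn1 ltxx adde0 big_ord_recr big_ord1 /= d0.
rewrite (L2sqE sf) (L2sqE (sd 1%N isT)) -EFinD => -[->].
by have := sqr_ge0 (Hnorm 1 f - 2^-1); nra.
Qed.

Lemma Hnorm0_le f : sq_int f -> Hnorm 0 f <= 1 + Ih (fun x => f x ^+ 2).
Proof.
move=> sf.
have If : inH 0 f.
  split => //; exists (fun j => f); rewrite /Hderivs truncn0.
  by split => //; split => //; split => //; rewrite ltxx.
have [d [d0 _] [H0 E]] := Hnorm_spec If.
move: E; rewrite /Hsq truncn0 ltxx adde0 big_ord1 /= d0.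
rewrite (L2sqE sf) => -[->].
by have := sqr_ge0 (Hnorm 0 f - 2^-1); nra.
Qed.

(** A Poincaré-type bound: [|f|] is at most the integral of [|g| <= 1 + g^2]. The inner [2^-1] is
    the integral of 1, the outer division by 2 the length of the interval. *)
Lemma Ih_sqr_le_deriv f g : {within Ihalfc, continuous f} -> weak_deriv f g ->
  f 0 = 0 -> sq_int f -> sq_int g ->
  Ih (fun x => f x ^+ 2) <= (2^-1 + Ih (fun x => g x ^+ 2)) ^+ 2 / 2.
Proof.
move=> cf wfg f0 sf sg; have Lg := sq_int_L1 sg.
rewrite -Ih_cst; apply: Ih_le; [exact: sq_int_L1sq|exact: L1_cst|].
move=> x /andP[x0 x2].
have -> : f x = prim g x by apply: weak_deriv_primE => //; rewrite /Ihalfc/= !ltW.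
rewrite -real_normK ?num_real// ler_pXn2r ?nnegrE//; last first.
  by rewrite addr_ge0 ?invr_ge0//; apply: Ih_ge0 => y _; exact: sqr_ge0.
apply: (le_trans (prim_bound x Lg)).
have <- : Ih (fun=> (1 : R)) = 2^-1 by rewrite Ih_cst mul1r.
rewrite -IhD; [|exact: L1_cst|exact: sq_int_L1sq].
apply: Ih_le; [exact: L1_abs|by apply: L1D; [exact: L1_cst|exact: sq_int_L1sq]|].
move=> y _; rewrite -(real_normK (num_real (g y))).
by have := sqr_ge0 (`|g y| - 2^-1); nra.
Qed.

End Quotients.

(** * Conservation of the energy and the resulting bound *)

Theorem theorem4p4 (R : realType) (kappa s : R) (u0 rho0 : R -> R)
  (T : \bar R) (u rho : R -> R -> R) :
  0 < kappa -> 2 <= s -> s < 5 / 2 ->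
  inH s u0 -> inH (s - 1) rho0 ->
  {within Ihalfc, continuous u0} -> {within Ihalfc, continuous rho0} ->
  u0 0 = 0 -> u0 (2^-1) = 0 -> rho0 0 = 0 -> rho0 (2^-1) = 0 ->
  is_maximal_solution kappa s u0 rho0 T u rho ->
  forall T' : R, 0 < T' ->
    exists M : R, forall t : R, 0 <= t -> (t%:E < T)%E -> t <= T' ->
      Hnorm 1 (u t) + Hnorm 0 (rho t) <= M.
Proof.
move=> k0 s2 s5 _ _ _ _ _ _ _ _ [[T0 [ut [rhot sol]]] _] T' _.
have [cu [cr [[cu1 [cut du]] [[_ [crt dr]] [_ [bc pde]]]]]] := sol.
have tr2 : Num.truncn s = 2%N by apply: truncn_def; lra.
have tr1 : Num.truncn (s - 1) = 1%N by apply: truncn_def; lra.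
(* The equations supply [u_x] for positive times only, whereas the energy is needed at 0 too; [v]
   and [z] are representatives of [u_x] and [u_tx] chosen on all of [[0, T)], with default 0
   elsewhere. *)
have [v Hv] : exists v : R -> R -> R, forall t, 0 <= t -> (t%:E < T)%E ->
    [/\ weak_deriv (u t) (v t), sq_int (u t) & sq_int (v t)].
  apply: (@choice _ _ (fun t (vt : R -> R) => 0 <= t -> (t%:E < T)%E ->
    [/\ weak_deriv (u t) vt, sq_int (u t) & sq_int vt])) => t.
  have [[t0 tT]|N] := pselect (0 <= t /\ (t%:E < T)%E); last first.
    by exists (fun=> 0) => t0 tT; case: N.
  by have [f' Hf'] := inH1P tr1 (cu1.1 t t0 tT); exists f'.
have [z Hz] : exists z : R -> R -> R, forall t, 0 <= t -> (t%:E < T)%E ->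
    weak_deriv (ut t) (z t) /\ sq_int (z t).
  apply: (@choice _ _ (fun t (vt : R -> R) => 0 <= t -> (t%:E < T)%E ->
    weak_deriv (ut t) vt /\ sq_int vt)) => t.
  have [[t0 tT]|N] := pselect (0 <= t /\ (t%:E < T)%E); last first.
    by exists (fun=> 0) => t0 tT; case: N.
  by have [f' [? ? ?]] := inH1P tr1 (cut.1 t t0 tT); exists f'.
have srho t : 0 <= t -> (t%:E < T)%E -> sq_int (rho t).
  by move=> t0 tT; have [f' []] := inH1P tr1 (cr.1 t t0 tT).
have srhot t : 0 <= t -> (t%:E < T)%E -> sq_int (rhot t).
  by move=> t0 tT; have [_ [d [<- [sd _]]]] := crt.1 t t0 tT; exact: sd.
pose E t := Ih (fun x => v t x ^+ 2) + kappa * Ih (fun x => rho t x ^+ 2).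
pose l t := 2 * Ih (fun x => v t x * z t x) + kappa * (2 * Ih (fun x => rho t x * rhot t x)).
have dE t : 0 <= t -> (t%:E < T)%E -> time_diff T E t (l t).
  move=> t0 tT; apply: time_diffDZ; apply: time_diff_L2sq => //.
  - by move=> t' t'0 t'T; have [] := Hv t' t'0 t'T.
  - by have [] := Hz t t0 tT.
  (* Convergence of the quotients of [u] in H^(s-1) contains L_2 convergence of those of [v]. *)
  - move=> e e0; have [d d0 H] := du t t0 tT e e0; exists d => // t' t'0 t'T tt td.
    have [wv _ sv] := Hv t t0 tT; have [wv' _ sv'] := Hv t' t'0 t'T.
    have [wz sz] := Hz t t0 tT.
    apply: Hnorm1_deriv_lt tr1 _ _ _ (H t' t'0 t'T tt td).
    + by apply: inH_quot; [exact: cu1.1|exact: cu1.1|exact: cut.1].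
    + exact: weak_deriv_quot.
    + exact: (sq_int_quot _ sv' sv sz).1.
  - exact: srhot.
  - move=> e e0; have [d d0 H] := dr t t0 tT e e0; exists d => // t' t'0 t'T tt td.
    apply: Hnorm0_lt (H t' t'0 t'T tt td).
    by apply: inH_quot; [exact: (sol.2.2.2.1.1).1|exact: (sol.2.2.2.1.1).1|exact: crt.1].
have l0 t : 0 < t -> (t%:E < T)%E -> l t = 0.
  move=> t0 tT; have t0' := ltW t0.
  have [ux [uxx [rhox [wu [wux [wr [mom trans]]]]]]] := pde t t0 tT.
  have [cut0 [crt0 [b1 [b2 [b3 _]]]]] := bc t t0' tT.
  have [wv su sv] := Hv t t0' tT; have [wz sz] := Hz t t0' tT.
  have [d1 [d2 [wd1 wd2 sd1 sd2]]] := inH2P tr2 (cu.1 t t0' tT).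
  have [r1 [wr1 _ sr1]] := inH1P tr1 (cr.1 t t0' tT).
  have refl (f : R -> R) : {ae (@lebesgue_measure R), forall x, Ihalf x -> f x = f x} by exact: aeW.
  (* The derivatives in the equations inherit square integrability from the H^s and H^(s-1)
     regularity. *)
  have ae1 := weak_deriv_unique wv wu (refl _).
  have ae2 := weak_deriv_unique wd2 wux (weak_deriv_unique wd1 wu (refl _)).
  have ae3 := weak_deriv_unique wr1 wr (refl _).
  have sux := sq_int_ae (L1_measurable wu.2.1) ae1 sv.
  have suxx := sq_int_ae (L1_measurable wux.2.1) ae2 sd2.
  have srx := sq_int_ae (L1_measurable wr.2.1) ae3 sr1.
  have := energy_identity wu wux wr wz sux suxx (srho _ t0' tT) srx sz (srhot _ t0' tT)
    cut0 crt0 b1 b2 b3 mom trans.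
  have <- : Ih (fun x => v t x * z t x) = Ih (fun x => ux x * z t x).
    apply: Ih_ae.
    - by apply: L1_measurable; exact: sq_int_mul.
    - by apply: L1_measurable; exact: sq_int_mul.
    - by apply: ae_imp ae1 => x h /h ->.
  by rewrite /l => H; rewrite mulrCA -mulrDr H mulr0.
(* [Hnorm1_le] and [Hnorm0_le], with [u_x^2] and [kappa rho^2] each of integral at most [E 0], and
   [u^2] bounded by [Ih_sqr_le_deriv]. *)
exists (1 + ((2^-1 + E 0) ^+ 2 / 2 + E 0) + (1 + E 0 / kappa)) => t t0 tT _.
have [wv su sv] := Hv t t0 tT.
have [cut0 [_ [b1 _]]] := bc t t0 tT.
have EE := time_diff_cst dE l0 t0 tT.
have A0 : 0 <= Ih (fun x => v t x ^+ 2) by apply: Ih_ge0 => x _; exact: sqr_ge0.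
have B0 : 0 <= Ih (fun x => rho t x ^+ 2) by apply: Ih_ge0 => x _; exact: sqr_ge0.
have A1 : Ih (fun x => v t x ^+ 2) <= E 0 by rewrite -EE lerDl mulr_ge0// ltW.
have B1 : Ih (fun x => rho t x ^+ 2) <= E 0 / kappa.
  by rewrite ler_pdivlMr// mulrC -EE lerDr.
apply: lerD.
  apply: (le_trans (Hnorm1_le wv su sv)); rewrite lerD2l lerD//.
  apply: (le_trans (Ih_sqr_le_deriv cut0 wv b1 su sv)).
  by rewrite ler_pM2r ?invr_gt0// ler_pXn2r ?nnegrE ?lerD2l// addr_ge0 ?invr_ge0// (le_trans A0).
by apply: (le_trans (Hnorm0_le (srho _ t0 tT))); rewrite lerD2l.
Qed.
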